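(* Let $p$ be a prime. For $i=1,2$ let $\mathcal{F}_i$ be a saturated fusion system over the finite $p$-group $S_i$, and let $\phi\colon S_1\to S_2$ be a fusion preserving homomorphism. Define $S_{i,0}=S_i$ and $S_{i,n+1}=S_{i,n}^p[S_{i,n},\mathcal{F}_i]$ for $i=1,2$ and $n\ge 0$. If the induced map in cohomology $H^i(\mathcal{F}_2;\mathbb{F}_p)\to H^i(\mathcal{F}_1;\mathbb{F}_p)$ is an isomorphism for $i=1$ and a monomorphism for $i=2$, then $S_1/S_{1,n}\cong S_2/S_{2,n}$ for each $n\ge 1$. In particular, taking $n$ big enough, $S_1/O^p_{\mathcal{F}_1}(S_1)\cong S_2/O^p_{\mathcal{F}_2}(S_2)$.
   Context: Fusion systems over finite $p$-groups are in the sense of Puig and Broto–Levi–Oliver: objects are the subgroups of $S$, morphisms are certain injective homomorphisms including those induced by conjugation in $S$, subject to the saturation axioms. A group homomorphism $\phi\colon S_1\to S_2$ is fusion preserving (with respect to $\mathcal{F}_1,\mathcal{F}_2$) if for each $P\le S_1$ and $\varphi\in \operatorname{Hom}_{\mathcal{F}_1}(P,S_1)$ there exists $\hat\varphi\in\operatorname{Hom}_{\mathcal{F}_2}(\phi(P),S_2)$ with $\phi\circ\varphi=\hat\varphi\circ\phi|_P$. For a fusion system $\mathcal{F}$ over $S$, $H^*(\mathcal{F};\mathbb{F}_p)=\{z\in H^*(S;\mathbb{F}_p)\mid \operatorname{res}(z)=\varphi^*(z)\text{ for each }P\le S,\ \varphi\in\operatorname{Hom}_{\mathcal{F}}(P,S)\}$,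 where $\operatorname{res}$ is restriction to $H^*(P;\mathbb{F}_p)$. If $\phi$ is fusion preserving then $\phi^*\colon H^*(S_2;\mathbb{F}_p)\to H^*(S_1;\mathbb{F}_p)$ restricts to the induced map $H^*(\mathcal{F}_2;\mathbb{F}_p)\to H^*(\mathcal{F}_1;\mathbb{F}_p)$. For a subgroup $T\le S$: $T^p=\langle t^p\mid t\in T\rangle$; $[T,\mathcal{F}]=\langle t\varphi(t^{-1})\mid t\in T,\ \varphi\in\operatorname{Hom}_{\mathcal{F}}(\langle t\rangle,T)\rangle$; and $T^p[T,\mathcal{F}]$ is the subgroup of $T$ generated by $T^p$ and $[T,\mathcal{F}]$ (when $T$ is strongly $\mathcal{F}$-closed, i.e. $\varphi(P)\le T$ for all $P\le T$ and $\varphi\in \operatorname{Hom}_{\mathcal{F}}(P,S)$, this equals the element-wise product). The hyperfocal subgroup of $\mathcal{F}$ is $O^p_{\mathcal{F}}(S)=\langle [P,O^p(\operatorname{Aut}_{\mathcal{F}}(P))]\mid P\le S\rangle$, where $O^p(\operatorname{Aut}_{\mathcal{F}}(P))$ is the smallest normal subgroup of $p$-power index in $\operatorname{Aut}_{\mathcal{F}}(P)$ and $[P,A]=\langle x^{-1}\alpha(x)\mid x\in P,\alpha\in A\rangle$. *)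

(* Defs.v *)
From HB Require Import structures.
From mathcomp Require Import all_boot all_order all_algebra.
From mathcomp Require Import all_fingroup all_solvable.

Set Implicit Arguments.
Unset Strict Implicit.
Unset Printing Implicit Defensive.

Import GRing.Theory.

(** H^n(G; F_p), with trivial coefficients, is taken as the
    cohomology of the inhomogeneous (bar) cochain complex. *)

Section Cochains.
Local Open Scope ring_scope.
Local Open Scope quotient_scope.
Variables (p : nat) (G : finGroupType).

Notation cochain n := {ffun {ffun 'I_n -> G} -> 'F_p}.

(* The i-th face (g_0, ..., g_n) |-> (g_0, ..., g_{i-1} g_i, ..., g_n), which
   drops g_0 when i = 0 and drops g_n when i = n + 1. *)
Definition face n (i : 'I_n.+2) (t : {ffun 'I_n.+1 -> G}) : {ffun 'I_n -> G} :=
  [ffun j : 'I_n =>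
     if (j.+1 < i)%N then t (widen_ord (leqnSn n) j)
     else if j.+1 == i then (t (widen_ord (leqnSn n) j) * t (lift ord0 j))%g
     else t (lift ord0 j)].

Definition differential n (c : cochain n) : cochain n.+1 :=
  [ffun t : {ffun 'I_n.+1 -> G} => \sum_(i < n.+2) (-1) ^+ i * c (face i t)].

Fact differential_is_zmod_morphism n : zmod_morphism (@differential n).
Proof.
move=> c d; apply/ffunP=> t; rewrite !ffunE -sumrB.
by apply: eq_bigr => i _; rewrite !ffunE mulrBr.
Qed.
HB.instance Definition _ n :=
  GRing.isZmodMorphism.Build (cochain n) (cochain n.+1)
    (@differential n) (@differential_is_zmod_morphism n).

Definition is_cocycle n : {pred cochain n} := [pred c | differential c == 0].

Fact is_cocycle_zmod_closed n : zmod_closed (@is_cocycle n).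
Proof.
split=> [|c d]; rewrite !inE ?raddf0 // => /eqP c0 /eqP d0.
by rewrite raddfB /= c0 d0 subrr.
Qed.
HB.instance Definition _ n :=
  GRing.isZmodClosed.Build (cochain n) (@is_cocycle n)
    (@is_cocycle_zmod_closed n).

Record cocycle n := Cocycle {
  cocycle_val :> cochain n;
  cocycle_valP : cocycle_val \in @is_cocycle n }.

HB.instance Definition _ n := [isSub for @cocycle_val n].
HB.instance Definition _ n := [Choice of cocycle n by <:].
HB.instance Definition _ n := [SubChoice_isSubZmodule of cocycle n by <:].

Definition is_coboundary n : {pred cocycle n} :=
  match n with
  | 0 => fun c : cocycle 0 => c == 0
  | m.+1 => fun c : cocycle m.+1 =>
      [exists b : cochain m, differential b == val c]
  end.

Fact is_coboundary_zmod_closed n : zmod_closed (@is_coboundary n).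
Proof.
case: n => [|n]; split.
- by rewrite unfold_in.
- by move=> c d; rewrite !unfold_in => /eqP-> /eqP->; rewrite subrr.
- by rewrite unfold_in; apply/existsP; exists 0; rewrite raddf0 raddf0.
move=> c d; rewrite !unfold_in => /existsP[b /eqP bc] /existsP[e /eqP ed].
by apply/existsP; exists (b - e); rewrite raddfB /= bc ed.
Qed.
HB.instance Definition _ n :=
  GRing.isZmodClosed.Build (cocycle n) (@is_coboundary n)
    (@is_coboundary_zmod_closed n).

Definition group_cohomology n := Quotient.quot (@is_coboundary n).
HB.instance Definition _ n := GRing.Zmodule.on (group_cohomology n).
HB.instance Definition _ n :=
  EqQuotient.on (group_cohomology n).


Lemma pi_cohomologyE n (c d : cocycle n) :
  (\pi_(group_cohomology n) c == \pi_(group_cohomology n) d) =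
  (c - d \in @is_coboundary n).
Proof. by rewrite piE. Qed.

End Cochains.

(** The map induced by f : G -> H is defined for every function f; it is the
    expected one for homomorphisms, for which the default value of [insubd] is
    never used ([val_cocycle_map], [cohomology_mapE]). *)

Section Functoriality.
Local Open Scope ring_scope.
Local Open Scope quotient_scope.
Variable p : nat.

Notation cochain G n := {ffun {ffun 'I_n -> G} -> 'F_p}.

Definition pullback (G H : finGroupType) (f : G -> H) n (c : cochain H n) :
  cochain G n := [ffun t : {ffun 'I_n -> G} => c [ffun i => f (t i)]].

Definition cocycle_map (G H : finGroupType) (f : G -> H) n (c : cocycle p H n) :
  cocycle p G n := insubd 0 (pullback f (val c)).

Definition cohomology_map (G H : finGroupType) (f : G -> H) n
    (z : group_cohomology p H n) : group_cohomology p G n :=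
  \pi_(group_cohomology p G n) (cocycle_map f (generic_quotient.repr z)).

Section Morph.
Variables (G H : finGroupType) (f : G -> H).
Hypothesis fM : {morph f : x y / (x * y)%g}.

Lemma pullback_differential n (c : cochain H n) :
  differential (pullback f c) = pullback f (differential c).
Proof.
apply/ffunP=> t; rewrite !ffunE; apply: eq_bigr => i _; rewrite !ffunE.
congr (_ * c _); apply/ffunP=> j; rewrite !ffunE.
by case: ifP => // _; case: ifP => // _; rewrite fM.
Qed.

Lemma val_cocycle_map n (c : cocycle p H n) :
  val (cocycle_map f c) = pullback f (val c).
Proof.
rewrite insubdK // inE pullback_differential.
have /eqP-> : differential (val c) == 0 := valP c.
by apply/eqP/ffunP=> t; rewrite !ffunE.
Qed.

Fact cocycle_map_is_zmod_morphism n : zmod_morphism (@cocycle_map G H f n).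
Proof.
move=> c d; apply: val_inj; rewrite raddfB /= !val_cocycle_map.
by apply/ffunP=> t; rewrite !ffunE.
Qed.

Lemma cocycle_map_coboundary n (c : cocycle p H n) :
  c \in @is_coboundary p H n -> cocycle_map f c \in @is_coboundary p G n.
Proof.
case: n c => [|n] c; rewrite !unfold_in.
  by move=> /eqP->; rewrite -(subrr 0) cocycle_map_is_zmod_morphism subrr.
case/existsP=> b /eqP db; apply/existsP; exists (pullback f b).
by rewrite pullback_differential val_cocycle_map db.
Qed.

Lemma cohomology_mapE n (c : cocycle p H n) :
  cohomology_map f (\pi_(group_cohomology p H n) c) =
  \pi_(group_cohomology p G n) (cocycle_map f c).
Proof.
apply/eqP; rewrite pi_cohomologyE -cocycle_map_is_zmod_morphism.
by apply: cocycle_map_coboundary; rewrite -pi_cohomologyE reprK.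
Qed.

Fact cohomology_map_is_zmod_morphism n :
  zmod_morphism (@cohomology_map G H f n).
Proof.
elim/quotW=> c; elim/quotW=> d.
rewrite -raddfB !cohomology_mapE cocycle_map_is_zmod_morphism.
by rewrite raddfB.
Qed.

End Morph.

Lemma cohomology_map_comp (G H K : finGroupType) (f : G -> H) (g : H -> K) n
    (z : group_cohomology p K n) :
  {morph f : x y / (x * y)%g} -> {morph g : x y / (x * y)%g} ->
  cohomology_map f (cohomology_map g z) = cohomology_map (g \o f) z.
Proof.
move=> fM gM; have gfM : {morph g \o f : x y / (x * y)%g}.
  by move=> x y; rewrite /= fM gM.
elim/quotW: z => c.
rewrite (cohomology_mapE gM) (cohomology_mapE fM) (cohomology_mapE gfM).
congr (\pi_(group_cohomology p G n) _).
apply: val_inj; rewrite !val_cocycle_map //.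
apply/ffunP=> t; rewrite !ffunE; congr (fun_of_fin _ _).
by apply/ffunP=> i; rewrite !ffunE.
Qed.

Lemma eq_cohomology_map (G H : finGroupType) (f g : G -> H) n :
  f =1 g -> @cohomology_map G H f n =1 @cohomology_map G H g n.
Proof.
move=> fg z; rewrite /cohomology_map /cocycle_map.
congr (\pi_(group_cohomology p G n) (insubd _ _)).
apply/ffunP=> t; rewrite !ffunE; congr (fun_of_fin _ _).
by apply/ffunP=> i; rewrite !ffunE.
Qed.

End Functoriality.

(** All groups in sight are subgroups of an ambient finite group type, and a
    morphism P -> Q is a function on that type, of which only the values on P
    matter. *)

Section FusionSystem.
Local Open Scope group_scope.
Variable gT : finGroupType.
Implicit Types P Q R S : {group gT}.

Definition hom_iso (hom : {group gT} -> {group gT} -> pred (gT -> gT)) P Q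
    (f : gT -> gT) : Prop :=
  hom P Q f /\
  exists g : gT -> gT, [/\ hom Q P g, {in P, cancel f g} & {in Q, cancel g f}].

(* [fhom P Q] is Hom_F(P, Q).  Identities and inclusions are the instances
   x = 1 of [fhom_conj]. *)
Record fusion_system (S : {group gT}) := FusionSystem {
  fhom : {group gT} -> {group gT} -> pred (gT -> gT);
  fhom_obj : forall P Q f, fhom P Q f -> P \subset S /\ Q \subset S;
  fhom_ext : forall P Q (f g : gT -> gT),
    {in P, f =1 g} -> fhom P Q f = fhom P Q g;
  fhom_comp : forall P Q R (f g : gT -> gT),
    fhom P Q f -> fhom Q R g -> fhom P R (g \o f);
  fhom_conj : forall P Q x,
    P \subset S -> Q \subset S -> x \in S -> P :^ x \subset Q ->
    fhom P Q (conjg^~ x);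
  fhom_inj : forall P Q (f : gT -> gT), fhom P Q f ->
    [/\ {in P &, {morph f : x y / x * y}}, {in P &, injective f}
      & {in P, forall x, f x \in Q}];
  fhom_factor : forall P Q (f : gT -> gT), fhom P Q f ->
    exists2 R : {group gT}, R \subset Q & hom_iso fhom P R f }.

Section Saturation.
Variables (p : nat) (S : {group gT}) (F : fusion_system S).

Definition fconj P Q : Prop := exists f : gT -> gT, hom_iso (fhom F) P Q f.

Definition fully_centralized P : Prop :=
  forall Q, fconj P Q -> #|'C_S(Q)| <= #|'C_S(P)|.

Definition fully_normalized P : Prop :=
  forall Q, fconj P Q -> #|'N_S(Q)| <= #|'N_S(P)|.

Definition fAut P : {set {perm gT}} :=
  [set a : {perm gT} in Aut P | fhom F P P a].

Lemma fhom_sub P Q : P \subset Q -> Q \subset S -> fhom F P Q id.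
Proof.
move=> sPQ sQS; rewrite -(@fhom_ext _ F _ _ (conjg^~ 1)) => [|x _].
  by apply: fhom_conj; rewrite ?group1 ?conjsg1 // (subset_trans sPQ).
exact: conjg1.
Qed.

Lemma fAut_group_set P : P \subset S -> group_set (fAut P).
Proof.
move=> sPS; apply/group_setP; split=> [|a b].
  rewrite inE group1 (@fhom_ext _ F _ _ _ id) ?fhom_sub // => x _.
  by rewrite perm1.
rewrite !inE => /andP[Aa Fa] /andP[Ab Fb].
have := @groupM _ (Aut_group P) a b; rewrite !inE => -> //=.
rewrite (@fhom_ext _ F _ _ _ (b \o a)) => [|x _]; last by rewrite permM.
exact: fhom_comp Fa Fb.
Qed.

(* N_f = {g in N_S(P) | f c_g f^-1 in Aut_S(f(P))} *)
Definition extender P (f : {morphism P >-> gT}) : {set gT} :=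
  [set g in 'N_S(P) | [exists h in 'N_S(f @* P),
                         [forall x in P, f (x ^ g) == f x ^ h]]].

Fact extender_group_set P (f : {morphism P >-> gT}) : group_set (extender f).
Proof.
apply/group_setP; split=> [|g1 g2].
  rewrite inE group1 /=; apply/existsP; exists 1; rewrite group1 /=.
  by apply/forall_inP=> x _; rewrite !conjg1.
case/setIdP=> Ng1 /exists_inP[h1 Nh1 /forall_inP fh1].
case/setIdP=> Ng2 /exists_inP[h2 Nh2 /forall_inP fh2].
have [_ NPg1] := setIP Ng1; rewrite inE groupM //=.
apply/exists_inP; exists (h1 * h2); first exact: groupM.
apply/forall_inP=> x Px; rewrite !conjgM -(eqP (fh1 _ Px)).
by apply: fh2; rewrite memJ_norm.
Qed.
Canonical extender_group P (f : {morphism P >-> gT}) :=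
  Group (extender_group_set f).

Definition saturated : Prop :=
  (forall P, P \subset S -> fully_normalized P ->
     fully_centralized P /\ p.-Sylow(fAut P) (conj_aut P @* 'N_S(P)))
  /\
  (forall P (f : {morphism P >-> gT}),
     fhom F P S f -> fully_centralized (f @* P)%G ->
     exists2 f' : gT -> gT, fhom F (extender f) S f' & {in P, f' =1 f}).

End Saturation.
End FusionSystem.

Section Series.
Local Open Scope group_scope.
Variables (p : nat) (gT : finGroupType) (S : {group gT}) (F : fusion_system S).

(* [T, F] *)
Definition fcomm (T : {group gT}) : {set gT} :=
  <<[set x | [exists t in T, exists f : {ffun gT -> gT},
                fhom F <[t]> T f && (x == t * f t^-1)]]>>.

(* T^p [T, F] *)
Definition fseries_step (T : {group gT}) : {group gT} :=
  (<<[set t ^+ p | t in T]>> <*> fcomm T)%G.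

Definition fseries (n : nat) : {group gT} := iter n fseries_step S.

(* O^p(A), the smallest normal subgroup of p-power index of the group A *)
Definition p_residual (aT : finGroupType) (A : {set aT}) : {set aT} :=
  \bigcap_(N : {group aT} | (N <| A) && p.-nat #|A : N|) N.

(* O^p_F(S) *)
Definition hyperfocal : {set gT} :=
  <<\bigcup_(P : {group gT} | P \subset S)
      <<[set x^-1 * (a : {perm gT}) x
           | x in P, a in p_residual (fAut F P)]>> >>.

Lemma fcommP (T : {group gT}) t (f : gT -> gT) :
  t \in T -> fhom F <[t]> T f -> t * f t^-1 \in fcomm T.
Proof.
move=> Tt Ff; apply/mem_gen; rewrite inE; apply/exists_inP; exists t => //.
apply/existsP; exists [ffun x => f x]; rewrite ffunE eqxx andbT.
by rewrite (@fhom_ext _ _ F _ _ _ f) // => x _; rewrite ffunE.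
Qed.

(* Each term of the series is strongly closed, hence normal in S. *)
Lemma fseries_closed n :
  fseries n \subset S /\
  forall t (f : gT -> gT), t \in fseries n -> fhom F <[t]> S f ->
    f t \in fseries n.
Proof.
elim: n => [|n [sTS clT]]; first split=> // t f _ Ff.
  by have [_ _ /(_ t (cycle_id t))] := fhom_inj Ff.
have sTT : fseries n.+1 \subset fseries n.
  rewrite join_subG !gen_subG; apply/andP; split; apply/subsetP=> x.
    by case/imsetP=> t Tt ->; rewrite groupX.
  rewrite inE => /exists_inP[t Tt /existsP[f /andP[Ff /eqP->]]].
  have [_ _ Tf] := fhom_inj Ff.
  by rewrite groupM // Tf // groupV cycle_id.
split=> [|t f Tt Ff]; first exact: subset_trans sTS.
have Tt' := subsetP sTT t Tt.
have [fM _ _] := fhom_inj Ff.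
have sfT x : x \in <[t]> -> f x \in fseries n.
  move=> tx; have Tx : x \in fseries n by apply: subsetP tx; rewrite cycle_subG.
  apply: clT => //; rewrite -[f]/(f \o id); apply: fhom_comp Ff.
  by apply: fhom_sub; rewrite cycle_subG // (subsetP sTS).
have FfT : fhom F <[t]> (fseries n) f.
  have [R sRS [FR [g [FRg fg gf]]]] := fhom_factor Ff.
  have sRT : R \subset fseries n.
    apply/subsetP=> y Ry; rewrite -(gf y Ry); apply: sfT.
    by have [_ _ ->] := fhom_inj FRg.
  by rewrite -[f]/(id \o f); apply: fhom_comp FR _; apply: fhom_sub.
have tfC := fcommP Tt' FfT.
have f1 : f 1 = 1.
  by apply: (mulgI (f 1)); rewrite -fM ?group1 // !mulg1.
have fV : f t^-1 = (f t)^-1.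
  by apply/eqP; rewrite eq_sym eq_invg_mul -fM ?groupV ?cycle_id // mulgV f1.
have Ttf : t * f t^-1 \in fseries n.+1 by exact: subsetP (joing_subr _ _) _ tfC.
have := groupM (groupVr Ttf) Tt.
by rewrite fV invMg invgK mulgKV.
Qed.

Lemma fseries_normal n : fseries n <| S.
Proof.
have [sTS clT] := fseries_closed n; rewrite /normal sTS /=.
apply/subsetP=> x Sx; rewrite inE; apply/subsetP=> _ /imsetP[t Tt ->].
apply: (clT t (conjg^~ x)) => //; have St := subsetP sTS t Tt.
apply: fhom_conj; rewrite ?cycle_subG //.
by rewrite -cycleJ cycle_subG groupJ.
Qed.

Lemma fAutJ (P : {group gT}) s :
  P \subset S -> s \in S ->
  fAut F (P :^ s) = fAut F P :^ perm (conjg_inj s).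
Proof.
have sub (Q : {group gT}) z a : Q \subset S -> z \in S -> a \in fAut F Q ->
    a ^ perm (conjg_inj z) \in fAut F (Q :^ z)%G.
  move=> sQS Sz; have sQzS : Q :^ z \subset S by rewrite -(conjGid Sz) conjSg.
  have cE x : (perm (conjg_inj z))^-1 x = x ^ z^-1.
    by apply: (@perm_inj _ (perm (conjg_inj z))); rewrite permKV permE conjgKV.
  rewrite !inE => /andP[/andP[/subsetP aQ /morphicP aM] Fa].
  have aE x : (a ^ perm (conjg_inj z)) x = a (x ^ z^-1) ^ z.
    by rewrite conjgE !permM cE permE.
  apply/andP; split.
    apply/andP; split.
      apply/subsetP=> x; rewrite inE aE mem_conjg => Nax; apply: aQ.
      rewrite inE; apply: contra Nax => /eqP->.
      by rewrite conjgKV.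
    apply/morphicP=> x y; rewrite /= !mem_conjg => Qx Qy.
    by rewrite !aE conjMg aM // conjMg.
  have F1 : fhom F (Q :^ z)%G Q (conjg^~ z^-1).
    by apply: fhom_conj; rewrite ?groupV //= conjsgK.
  have F2 : fhom F Q (Q :^ z)%G (conjg^~ z) by apply: fhom_conj.
  rewrite (@fhom_ext _ _ F _ _ _ (conjg^~ z \o (a \o conjg^~ z^-1))) => [|x _].
    exact: fhom_comp (fhom_comp F1 Fa) F2.
  exact: aE.
move=> sPS Ss; apply/eqP; rewrite eqEsubset andbC; apply/andP; split.
  by apply/subsetP=> _ /imsetP[a Fa ->]; apply: sub.
apply/subsetP=> a Fa; rewrite mem_conjg.
have sPsS : P :^ s \subset S by rewrite -(conjGid Ss) conjSg.
have := sub (P :^ s)%G s^-1 a sPsS (groupVr Ss) Fa.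
have -> : conjG_group (conjG_group P s) s^-1 = P.
  by apply: val_inj; rewrite /= conjsgK.
have -> // : perm (conjg_inj s^-1) = (perm (conjg_inj s))^-1.
apply: (mulgI (perm (conjg_inj s))); rewrite mulgV.
by apply/permP=> x; rewrite permM !permE conjgK.
Qed.

Lemma p_residualJ (aT : finGroupType) (A : {group aT}) c :
  p_residual (A :^ c) = p_residual A :^ c.
Proof.
have sub (B : {group aT}) d : p_residual (B :^ d) \subset p_residual B :^ d.
  apply/subsetP=> x /bigcapP xB; rewrite mem_conjg; apply/bigcapP=> N nN.
  rewrite -mem_conjg; apply: (xB (N :^ d)%G).
  by rewrite /= normalJ indexJg.
apply/eqP; rewrite eqEsubset sub /=.
have := sub (A :^ c)%G c^-1; rewrite /= conjsgK => sAc.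
by rewrite -[p_residual (A :^ c)](conjsgKV c) conjSg.
Qed.

Lemma hyperfocal_normal : hyperfocal <| S.
Proof.
apply/andP; split.
  rewrite gen_subG; apply/bigcupsP=> P sPS; rewrite gen_subG.
  apply/subsetP=> _ /imset2P[x a Px Oa ->].
  have gA := fAut_group_set F sPS.
  have: a \in Group gA.
    apply: (bigcapP Oa (Group gA)).
    by rewrite (normal_refl (Group gA)) (indexgg (Group gA)).
  rewrite inE => /andP[Aa _].
  by rewrite (subsetP sPS) // groupM ?groupV // Aut_closed.
apply/subsetP=> s Ss; rewrite inE -genJ genS //.
apply/subsetP=> _ /imsetP[y /bigcupP[P sPS Py] ->].
have sPsS : P :^ s \subset S by rewrite -(conjGid Ss) conjSg.
apply/bigcupP; exists (P :^ s)%G => //.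
have gA := fAut_group_set F sPS.
rewrite /= fAutJ // (p_residualJ (Group gA)) /=.
move: Py; rewrite -(memJ_conjg _ s) -genJ; apply: subsetP; apply: genS.
apply/subsetP=> _ /imsetP[_ /imset2P[x a Px Oa ->] ->].
apply/imset2P; exists (x ^ s) (a ^ perm (conjg_inj s)); rewrite ?memJ_conjg //.
rewrite conjMg conjVg; congr (_ * _).
have -> : x ^ s = perm (conjg_inj s) x by rewrite permE.
by rewrite conjgE !permM permK permE.
Qed.

End Series.

Section FusionCohomology.
Local Open Scope group_scope.
Local Open Scope quotient_scope.

(* The map P -> Q between the groups underlying P and Q given by f. *)
Definition subg_map (gT rT : finGroupType) (P : {group gT}) (Q : {group rT})
  (f : gT -> rT) : subg_of P -> subg_of Q := subg Q \o f \o sgval.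

Section SubgMap.
Variables (gT rT : finGroupType) (P : {group gT}) (Q : {group rT}).
Variable f : gT -> rT.
Hypothesis fQ : {in P, forall x, f x \in Q}.

Lemma subg_mapE (x : subg_of P) : val (subg_map Q f x) = f (val x).
Proof. by rewrite /= subgK ?fQ ?subgP. Qed.

Lemma subg_mapM :
  {in P &, {morph f : x y / x * y}} ->
  {morph @subg_map _ _ P Q f : x y / x * y}.
Proof.
move=> fM x y; apply: val_inj.
by rewrite subg_mapE [val _]/= fM ?subgP // -!subg_mapE.
Qed.
End SubgMap.

Variable p : nat.

Section Stable.
Variables (gT : finGroupType) (S : {group gT}) (F : fusion_system S) (n : nat).

(* Since [fhom] only depends on values, finite functions represent all
   morphisms. *)
Definition stable : {pred group_cohomology p (subg_of S) n} :=
  [pred z | [forall P : {group gT}, forall f : {ffun gT -> gT},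
    fhom F P S f ==>
      (cohomology_map (@subg_map _ _ P S id) z
         == cohomology_map (@subg_map _ _ P S f) z)]].

Lemma stableP (z : group_cohomology p (subg_of S) n) :
  reflect (forall (P : {group gT}) (f : gT -> gT), fhom F P S f ->
             cohomology_map (@subg_map _ _ P S id) z
             = cohomology_map (@subg_map _ _ P S f) z)
          (z \in stable).
Proof.
apply: (iffP forallP) => [zF P f Ff | zF P].
  have ef : [ffun x => f x] =1 f by move=> x; rewrite ffunE.
  move: (forallP (zF P) [ffun x => f x]).
  rewrite (@fhom_ext _ _ F _ _ _ f) => [|x _]; last exact: ef.
  rewrite Ff => /eqP->; apply: eq_cohomology_map => x.
  by rewrite /subg_map /= ef.
by apply/forallP=> f; apply/implyP=> Ff; apply/eqP/zF.
Qed.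

Fact stable_zmod_closed : zmod_closed stable.
Proof.
have incM P f : fhom F P S f ->
    {morph @subg_map _ _ P S id : x y / x * y} /\
    {morph @subg_map _ _ P S f : x y / x * y}.
  move=> Ff; have [fM _ fS] := fhom_inj Ff.
  have [/subsetP sPS _] := fhom_obj Ff.
  by split; apply: subg_mapM.
have mapB P f : fhom F P S f -> forall y z,
    cohomology_map (@subg_map _ _ P S id) (y - z)%R = 
    (cohomology_map (@subg_map _ _ P S id) y
     - cohomology_map (p := p) (n := n) (@subg_map _ _ P S id) z)%R /\
    cohomology_map (@subg_map _ _ P S f) (y - z)%R = 
    (cohomology_map (@subg_map _ _ P S f) y
     - cohomology_map (p := p) (n := n) (@subg_map _ _ P S f) z)%R.
  move=> Ff y z; have [? ?] := incM _ _ Ff.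
  by rewrite !cohomology_map_is_zmod_morphism.
split=> [|y z /stableP yF /stableP zF]; apply/stableP=> P f Ff.
  by rewrite -(subrr 0%R); have [-> ->] := mapB _ _ Ff 0%R 0%R; rewrite !subrr.
by have [-> ->] := mapB _ _ Ff y z; rewrite (yF P f) // (zF P f).
Qed.
HB.instance Definition _ :=
  GRing.isZmodClosed.Build (group_cohomology p (subg_of S) n) stable
    stable_zmod_closed.

(* H^n(F; F_p) *)
Record fusion_cohomology := FusionCohomology {
  fusion_cohomology_val :> group_cohomology p (subg_of S) n;
  fusion_cohomology_valP : fusion_cohomology_val \in stable }.

HB.instance Definition _ := [isSub for fusion_cohomology_val].
HB.instance Definition _ := [Choice of fusion_cohomology by <:].
HB.instance Definition _ := [SubChoice_isSubZmodule of fusion_cohomology by <:].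
End Stable.

Section Induced.
Variables (gT1 gT2 : finGroupType) (S1 : {group gT1}) (S2 : {group gT2}).
Variables (F1 : fusion_system S1) (F2 : fusion_system S2).
Variable phi : {morphism S1 >-> gT2}.

Definition fusion_preserving : Prop :=
  forall (P : {group gT1}) (f : gT1 -> gT1), P \subset S1 -> fhom F1 P S1 f ->
    exists2 f' : gT2 -> gT2, fhom F2 (phi @* P)%G S2 f'
                           & {in P, forall x, phi (f x) = f' (phi x)}.

Hypothesis phiF : fusion_preserving.

Lemma fusion_preserving_sub : {in S1, forall x, phi x \in S2}.
Proof.
move=> x Sx; have F1id := fhom_sub F1 (subxx S1) (subxx S1).
have [f' Ff' _] := phiF (subxx S1) F1id.
by have [/subsetP-> //] := fhom_obj Ff'; rewrite mem_morphim.
Qed.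

Lemma induced_stable n (z : fusion_cohomology F2 n) :
  cohomology_map (@subg_map _ _ S1 S2 phi) (val z) \in @stable _ _ F1 n.
Proof.
apply/stableP=> P f Ff; have [sPS _] := fhom_obj Ff.
have PS x : x \in P -> x \in S1 by exact: (subsetP sPS).
have [fM _ fS] := fhom_inj Ff; have [f' Ff' ff'] := phiF sPS Ff.
have [f'M _ f'S] := fhom_inj Ff'; have [sQS _] := fhom_obj Ff'.
have phiS := fusion_preserving_sub.
pose Q := (phi @* P)%G.
have phiQ : {in P, forall x, phi x \in Q}.
  by move=> x Px; rewrite mem_morphim ?PS.
have QS : {in Q, forall x, x \in S2} by exact: (subsetP sQS).
have phiM : {in P &, {morph phi : x y / x * y}}.
  by move=> x y Px Py; rewrite morphM ?PS.
have m1 := subg_mapM phiS (@morphM _ _ _ phi).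
have m2 : {morph @subg_map _ _ P S1 id : x y / x * y} by exact: subg_mapM.
have m3 := subg_mapM fS fM.
have m4 := subg_mapM phiQ phiM.
have m5 : {morph @subg_map _ _ Q S2 id : x y / x * y} by exact: subg_mapM.
have m6 := subg_mapM f'S f'M.
rewrite !cohomology_map_comp //.
transitivity (cohomology_map (@subg_map _ _ P Q phi)
                (cohomology_map (@subg_map _ _ Q S2 id) (val z))).
  rewrite cohomology_map_comp //; apply: eq_cohomology_map => x.
  apply: val_inj.
  by rewrite /comp !subg_mapE //= ?subg_mapE ?subgK ?PS ?phiQ ?subgP.
rewrite (elimT (stableP _ _) (valP z) Q f' Ff') cohomology_map_comp //.
apply: eq_cohomology_map => x.
apply: val_inj.
rewrite /= !subgK ?fS ?phiQ ?subgP ?phiS ?fS ?f'S ?phiQ ?subgP //.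
by rewrite ff' ?subgP.
Qed.

(* H^n(F2; F_p) -> H^n(F1; F_p); bijectivity of this additive map is the same
   as its being an isomorphism of F_p-vector spaces. *)
Definition induced_map n (z : fusion_cohomology F2 n) :
    fusion_cohomology F1 n :=
  FusionCohomology (induced_stable z).

Fact induced_map_is_zmod_morphism n : zmod_morphism (@induced_map n).
Proof.
move=> y z; apply: val_inj; rewrite raddfB.
apply: cohomology_map_is_zmod_morphism; apply: subg_mapM.
  exact: fusion_preserving_sub.
exact: morphM.
Qed.
HB.instance Definition _ n :=
  GRing.isZmodMorphism.Build (fusion_cohomology F2 n) (fusion_cohomology F1 n)
    (@induced_map n) (@induced_map_is_zmod_morphism n).

End Induced.
End FusionCohomology.

Arguments saturated {gT} p {S} F.
Arguments fseries p {gT S} F n.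
Arguments hyperfocal p {gT S} F.
Arguments induced_map p {gT1 gT2 S1 S2 F1 F2 phi} phiF n z.

(* Main.v *)
Require Import Defs.
From mathcomp Require Import all_boot all_order all_algebra.
From mathcomp Require Import all_fingroup all_solvable all_character.
From mathcomp Require Import ring.

Set Implicit Arguments.
Unset Strict Implicit.
Unset Printing Implicit Defensive.

Local Open Scope group_scope.

(** Write N for the hyperfocal subgroup of F and T_n for the n-th term of the
    series; N <= T_n for all n, with equality for n large. Alperin's argument
    shows that modulo N every morphism of F is conjugation by an element of S.
    Hence every character of S that vanishes on N is F-stable.

    Stallings' argument then goes by induction on n. Given an F1-stable
    character chi1 of T1_n, extend it to a function sigma1 on S1 whose
    coboundary depends only on classes modulo T1_n. Through
    S1/T1_n = S2/T2_n this coboundary becomes a 2-cocycle c on S2. Its class is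
    F2-stable, as f ~ conjugation modulo T2_n, and it dies in H^2(F1). So
    c = d(sigma2), and sigma2 restricts to an S2-invariant character of T2_n.

    The key point is that sigma2 can be corrected by a homomorphism S2 -> F_p
    so that its restriction to T2_n becomes F2-stable; then sigma2 o phi - sigma1
    is an F1-stable homomorphism on S1, hence vanishes on T1_1, and so the
    character found extends chi1 along phi. The correction is a transfer along a
    virtual characteristic biset: an integral combination of (S x S)-sets
    (S x S)/{(x, h x) | x in P}, with h in Hom_F(P, S), whose marks are
    F-stable and whose degree is prime to p. For a graph (P, h) one may
    take h to be the identity modulo T; then sigma o h - sigma is a homomorphism
    on P, and the correction is the sum of its transfers to S. Its values on T
    can be expressed by the marks of the biset, so they are F-stable. *)

(** * Alperin's argument modulo the hyperfocal subgroup *)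

Section FusionMorphisms.
Variables (gT : finGroupType) (S : {group gT}) (F : fusion_system S).
Implicit Types P Q R : {group gT}.

Lemma fhomM P Q f : fhom F P Q f -> {in P &, {morph f : x y / x * y}}.
Proof. by case/fhom_inj. Qed.

Lemma fhom_injective P Q f : fhom F P Q f -> {in P &, injective f}.
Proof. by case/fhom_inj. Qed.

Lemma fhom_img P Q f x : fhom F P Q f -> x \in P -> f x \in Q.
Proof. by case/fhom_inj=> _ _ fQ /fQ. Qed.

Lemma fhom_dom P Q f : fhom F P Q f -> P \subset S.
Proof. by case/fhom_obj. Qed.

Lemma fhom_cod P Q f : fhom F P Q f -> Q \subset S.
Proof. by case/fhom_obj. Qed.

Lemma eq_fhom P Q f f' : {in P, f =1 f'} -> fhom F P Q f -> fhom F P Q f'.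
Proof. by move=> /(@fhom_ext _ _ F _ Q) ->. Qed.

Definition fhom_morphism P Q f (Ff : fhom F P Q f) : {morphism P >-> gT} :=
  Morphism (fhomM Ff).

Lemma fhom1 P Q f : fhom F P Q f -> f 1 = 1.
Proof. by move=> Ff; rewrite -[f](erefl : _ = fhom_morphism Ff :> (gT -> gT)) morph1. Qed.

Lemma fhomV P Q f x : fhom F P Q f -> x \in P -> f x^-1 = (f x)^-1.
Proof.
by move=> Ff Px; rewrite -[f](erefl : _ = fhom_morphism Ff :> (gT -> gT)) morphV.
Qed.

Lemma fhomX P Q f x n : fhom F P Q f -> x \in P -> f (x ^+ n) = f x ^+ n.
Proof.
by move=> Ff Px; rewrite -[f](erefl : _ = fhom_morphism Ff :> (gT -> gT)) morphX.
Qed.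

Lemma fhomJ P Q f x y :
  fhom F P Q f -> x \in P -> y \in P -> f (x ^ y) = f x ^ f y.
Proof.
move=> Ff Px Py.
by rewrite -[f](erefl : _ = fhom_morphism Ff :> (gT -> gT)) morphJ.
Qed.

Lemma fhom_restr P Q R f : fhom F P Q f -> R \subset P -> fhom F R Q f.
Proof.
move=> Ff sRP; rewrite -[f]/(f \o id); apply: (fhom_comp _ Ff).
exact: fhom_sub (fhom_dom Ff).
Qed.

(** A morphism factors as an isomorphism onto its image [R0] followed by an inclusion, and [R0] lies
    in [R]. *)
Lemma fhom_corestr P Q R f :
    fhom F P Q f -> R \subset S -> {in P, forall x, f x \in R} ->
  fhom F P R f.
Proof.
move=> Ff sRS fR; have [R0 _ [Ff0 [g [Fg _ gf]]]] := fhom_factor Ff.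
rewrite -[f]/(id \o f); apply: fhom_comp Ff0 _; apply: fhom_sub => //.
by apply/subsetP=> y R0y; rewrite -(gf y R0y) fR ?(fhom_img Fg).
Qed.

Lemma fhom_hom_iso P Q R f :
  fhom F P Q f -> f @: P = R -> hom_iso (fhom F) P R f.
Proof.
move=> Ff fPR; have [R0 _ [Ff0 [g [Fg fg gf]]]] := fhom_factor Ff.
suffices -> : R = R0 by split; last by exists g.
apply/val_inj=> /=; rewrite -fPR; apply/setP=> y; apply/imsetP/idP=> [[x Px ->]|R0y].
  exact: fhom_img Ff0 Px.
by exists (g y); rewrite ?gf ?(fhom_img Fg).
Qed.

Lemma hom_iso_img P R f : hom_iso (fhom F) P R f -> f @: P = R.
Proof.
case=> Ff [g [Fg fg gf]]; apply/setP=> y; apply/imsetP/idP=> [[x Px ->]|Ry].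
  exact: fhom_img Ff Px.
by exists (g y); rewrite ?gf ?(fhom_img Fg).
Qed.

Lemma fconj_sym P Q : fconj F P Q -> fconj F Q P.
Proof. by case=> f [Ff [g [Fg fg gf]]]; exists g; split=> //; exists f. Qed.

Lemma fconj_trans P Q R : fconj F P Q -> fconj F Q R -> fconj F P R.
Proof.
case=> f [Ff [g [Fg fg gf]]] [f' [Ff' [g' [Fg' fg' gf']]]].
exists (f' \o f); split; first exact: fhom_comp Ff Ff'.
exists (g \o g'); split; first exact: fhom_comp Fg' Fg.
  by move=> x Px /=; rewrite fg' ?fg ?(fhom_img Ff).
by move=> x Rx /=; rewrite gf ?gf' ?(fhom_img Fg').
Qed.

Lemma fconj_refl P : P \subset S -> fconj F P P.
Proof.
move=> sPS; have F1 := fhom_sub F (subxx P) sPS.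
by exists id; split=> //; exists id.
Qed.

Lemma fconj_card P Q : fconj F P Q -> #|P| = #|Q|.
Proof.
case=> f isof; have [Ff _] := isof.
by rewrite -(hom_iso_img isof) card_in_imset //; apply: fhom_injective Ff.
Qed.

(** Finite functions represent all morphisms, so F-conjugacy is decidable and a conjugate with
    largest normalizer can be picked. *)
Lemma fconjP P Q :
  reflect (fconj F P Q)
          [exists f : {ffun gT -> gT}, fhom F P Q f && (f @: P == Q)].
Proof.
apply: (iffP existsP) => [[f /andP[Ff /eqP fPQ]] | [f isof]].
  by exists f; apply: fhom_hom_iso Ff fPQ.
exists [ffun x => f x]; have [Ff _] := isof.
rewrite (@fhom_ext _ _ F _ _ _ f) => [|x _]; last by rewrite ffunE.
rewrite Ff /= -(hom_iso_img isof); apply/eqP/eq_imset => x.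
by rewrite ffunE.
Qed.

Lemma ex_fully_normalized P :
  P \subset S -> exists2 Q, fconj F P Q & fully_normalized F Q.
Proof.
move=> sPS.
pose A := [pred Q : {group gT} |
  [exists f : {ffun gT -> gT}, fhom F P Q f && (f @: P == Q)]].
have AE Q : reflect (fconj F P Q) (A Q) by apply: fconjP.
have AP : A P by apply/AE/fconj_refl.
case: (arg_maxnP (fun Q : {group gT} => #|'N_S(Q)|) AP) => Q /AE PQ maxQ.
by exists Q => // R QR; apply: maxQ; apply/AE/(fconj_trans PQ).
Qed.

End FusionMorphisms.

(** * Extending isomorphisms onto fully normalized subgroups *)

Section Saturated.
Variables (p : nat) (gT : finGroupType) (S : {group gT}) (F : fusion_system S).
Hypothesis satF : saturated p F.
Implicit Types P Q R : {group gT}.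

Definition fAut_group P (sPS : P \subset S) : {group {perm gT}} :=
  Group (fAut_group_set F sPS).

Lemma fAutP P a : a \in fAut F P -> a \in Aut P /\ fhom F P P a.
Proof. by rewrite inE => /andP. Qed.

(** Carried along [f], Aut_S(P) becomes a p-subgroup of Aut_F(Q), which Sylow's theorem moves into
    Aut_S(Q). After this twist the extension axiom reaches all of N_S(P). *)
Lemma ext_to_normalized P Q f : p.-group S ->
    fully_normalized F Q -> fhom F P Q f -> f @: P = Q ->
  exists2 g, fhom F 'N_S(P)%G S g & g @: P = Q.
Proof.
move=> pS nQ Ff fPQ; have [satN satE] := satF.
have [sPS sQS] := fhom_obj Ff.
have [cQ sylQ] := satN Q sQS nQ.
pose fm := fhom_morphism Ff.
have injf : 'injm fm by apply/injmP; exact: fhom_injective Ff.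
have fmP : fm @* P = Q by rewrite morphimEdom.
have [_ [f' [Ff' f'K fK']]] := fhom_hom_iso Ff fPQ.
pose AS := conj_aut P @* 'N_S(P).
have sNP : 'N_S(P) \subset 'N(P) by apply: subsetIr.
have sASA : AS \subset Aut P by exact: Aut_conj_aut.
pose I := Aut_isom_morphism injf (subxx P).
pose B := I @* AS.
have pB : p.-group B by rewrite !morphim_pgroup // (pgroupS _ pS) ?subsetIl.
have IE a x : a \in Aut P -> x \in P -> I a (f x) = f (a x).
  by move=> Aa Px; rewrite /= -[f]/(fm : gT -> gT) Aut_isomE.
have sBA : B \subset fAut_group sQS.
  apply/subsetP=> _ /morphimP[_ _ /morphimP[x Nx Sx ->] ->].
  rewrite /= inE -{1}fmP Aut_Aut_isom /=.
  apply: (@eq_fhom _ _ _ _ _ (f \o ((conjg^~ x) \o f'))).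
    move=> y Qy; rewrite -{2}(fK' y Qy) -[RHS]/(I _ (f (f' y))).
    rewrite IE ?(fhom_img Ff') //; last by rewrite (subsetP sASA) ?mem_morphim.
    by rewrite norm_conj_autE ?(fhom_img Ff').
  apply: (fhom_comp _ Ff); apply: (fhom_comp Ff'); apply: fhom_conj => //.
    by case/setIP: Sx.
  by rewrite (normP Nx).
(* Aut_S(Q) is a Sylow subgroup because [Q] is fully normalized; replacing [f] by [a^-1 \o f] puts
   the image of Aut_S(P) inside it. *)
have [a Aa sBa] :=
  @Sylow_subJ p _ (fAut_group sQS) (conj_aut Q @* 'N_S(Q))%G (I @* (conj_aut P @* 'N_S(P)))%G
    sylQ sBA pB.
pose h := a^-1 \o f : gT -> gT.
have [AAa Fa] := fAutP (groupVr Aa).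
have Fh : fhom F P Q h by apply: fhom_comp Ff Fa.
have hPQ : h @: P = Q.
  rewrite /h imset_comp fPQ; apply/eqP; rewrite eqEcard.
  rewrite (card_imset _ (@perm_inj _ _)) leqnn andbT.
  by apply/subsetP=> _ /imsetP[y Qy ->]; apply: fhom_img Fa Qy.
have FhS : fhom F P S h.
  by apply: (fhom_corestr Fh) => // x Px; rewrite (subsetP sQS) ?(fhom_img Fh).
pose hm := fhom_morphism FhS.
have hmP : (hm @* P)%G = Q by apply/val_inj; rewrite /= morphimEdom.
have [|g Fg gh] := satE P hm FhS; first by rewrite hmP.
exists g; last by rewrite -hPQ; apply: eq_in_imset.
(* It remains to find, for each [x] in N_S(P), a partner [b] in N_S(Q) inducing the transported
   automorphism. *)
apply: (fhom_restr Fg); apply/subsetP=> x NSx.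
have [Sx Nx] := setIP NSx.
rewrite /= inE NSx /=; apply/exists_inP.
have /(subsetP sBa) : I (conj_aut P x) \in B.
  by rewrite mem_morphim ?mem_morphim //; apply: (subsetP sASA); rewrite mem_morphim.
case/imsetP=> _ /morphimP[b Nb SNb ->] Ixb.
exists b; first by rewrite [hm @* P](congr1 val hmP).
apply/forall_inP=> y Py; apply/eqP.
have Qhy := fhom_img Fh Py.
rewrite /= /h /= -(norm_conj_autE Nb) //.
have AxP : conj_aut P x \in Aut P by apply: (subsetP sASA); rewrite mem_morphim.
rewrite -(norm_conj_autE Nx Py) -IE // Ixb conjgE !permM.
by rewrite permK.
Qed.
End Saturated.

Section CosetEq.
Variables (gT : finGroupType) (T : {group gT}).

Lemma eq_cosetP x y : x \in 'N(T) -> y \in 'N(T) ->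
  reflect (coset T x = coset T y) (x^-1 * y \in T).
Proof.
move=> Nx Ny; have NVx : x^-1 \in 'N(T) by rewrite groupV.
rewrite -[x^-1 * y \in T]/(x^-1 * y \in gval T).
apply: (iffP idP) => [xyT | exy].
  by apply/eqP; rewrite eq_mulVg1 -morphV // -morphM //= coset_id.
by apply: coset_idr; rewrite ?groupM // morphM // morphV //= exy mulVg.
Qed.
End CosetEq.

(** * The p-residual of a finite group *)

Section PResidual.
Variables (p : nat) (aT : finGroupType).
Implicit Types A B N : {group aT}.

Lemma p_residual_sub A N : N <| A -> p.-nat #|A : N| -> p_residual p A \subset N.
Proof. by move=> nN pN; apply: bigcap_inf; rewrite nN. Qed.

(** Normal subgroups of p-power index are closed under intersection, so one of least order lies in
    all the others. *)
Lemma p_residual_normal A :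
  exists N : {group aT}, [/\ N <| A, p.-nat #|A : N| & p_residual p A = N].
Proof.
pose K := [pred N : {group aT} | (N <| A) && p.-nat #|A : N|].
have KA : K A by rewrite /= normal_refl indexgg.
case: (arg_minnP (fun N : {group aT} => #|N|) KA) => N /andP[nN pN] minN.
exists N; split=> //; apply/eqP; rewrite eqEsubset p_residual_sub //=.
apply/bigcapsP=> M /andP[nM pM].
have sNA := normal_sub nN; have sMA := normal_sub nM.
have nNM : N :&: M <| A by apply: normalI.
suffices: K (N :&: M)%G.
  move/minN=> leN; apply/setIidPl/eqP.
  by rewrite eqEcard subsetIl.
rewrite /= nNM -(Lagrange_index sNA (subsetIl N M)) pnatM pN /= indexgI.
have nMN := subset_trans sNA (normal_norm nM).
apply: pnat_dvd pM; have -> : #|N : M| = #|M <*> N : M|.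
  apply/eqP; rewrite -(eqn_pmul2l (cardG_gt0 M)) LagrangeMl.
  by rewrite (Lagrange (joing_subl M N)) /= norm_joinEr.
by apply: indexSg; rewrite ?joing_subl // join_subG sMA.
Qed.

(** The index in [A] of the product of [B] and the residual divides both a p'-number and a power of
    p. *)
Lemma Sylow_mul_p_residual A B :
  prime p -> p.-Sylow(A) B -> A \subset B * p_residual p A.
Proof.
move=> p_pr sylB; have [N [nN pN ->]] := p_residual_normal A.
have sBA := pHall_sub sylB.
have nBN : B \subset 'N(N) by apply: subset_trans (normal_norm nN).
rewrite -(norm_joinEl nBN) -indexg_eq1.
have sJ : B <*> N \subset A by rewrite join_subG sBA normal_sub.
have p'i : p^'.-nat #|A : B <*> N|.
  have [_ _] := and3P sylB; apply: pnat_dvd.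
  by apply: indexgS; exact: joing_subl.
have pi : p.-nat #|A : B <*> N|.
  by apply: pnat_dvd pN; apply: indexgS; exact: joing_subr.
by rewrite -(@pnat_1 p #|A : B <*> N|) ?eqxx.
Qed.
End PResidual.

(** * Fusion modulo a normal subgroup containing the hyperfocal subgroup *)

Section ModHyperfocal.
Variables (p : nat) (gT : finGroupType) (S : {group gT}) (F : fusion_system S).
Hypotheses (p_pr : prime p) (pS : p.-group S) (satF : saturated p F).
Implicit Types P Q R T : {group gT}.

(** Elements of [fAut] are permutations fixing everything outside [Q], while only the values of [h]
    on [Q] matter; [aut] supplies the permutation. *)
Lemma fAut_of_fhom Q h :
  fhom F Q Q h -> exists2 a, a \in fAut F Q & {in Q, a =1 h}.
Proof.
move=> Fh; pose hm := fhom_morphism Fh.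
have injh : 'injm hm by apply/injmP; exact: fhom_injective Fh.
have imh : hm @* Q = Q.
  apply/eqP; rewrite eqEcard card_injm // leqnn andbT.
  by apply/subsetP=> _ /morphimP[x Qx _ ->]; apply: (fhom_img Fh).
exists (aut injh imh) => [|x Qx]; last by rewrite autE.
rewrite inE Aut_aut /=; apply: (eq_fhom _ Fh) => x Qx.
by rewrite autE.
Qed.

Lemma mem_hyperfocal P a x :
  P \subset S -> a \in p_residual p (fAut F P) -> x \in P ->
  x^-1 * a x \in hyperfocal p F.
Proof.
move=> sPS Oa Px; apply: mem_gen; apply/bigcupP; exists P => //.
by apply: mem_gen; apply/imset2P; exists x a.
Qed.

Section Mod.
Variable T : {group gT}.
Hypotheses (nTS : T <| S) (sNT : hyperfocal p F \subset T).

Let sSN : S \subset 'N(T) := normal_norm nTS.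

Definition conj_mod P f :=
  exists2 s, s \in S & {in P, forall x, coset T (f x) = coset T (x ^ s)}.

Lemma cosetJ x s : x \in S -> s \in S -> coset T (x ^ s) = coset T x ^ coset T s.
Proof. by move=> Sx Ss; rewrite morphJ ?(subsetP sSN). Qed.

(** As [Q] is fully normalized, Aut_F(Q) is the product of Aut_S(Q) and its p-residual; the latter
    moves points only within the hyperfocal subgroup. *)
Lemma conj_mod_fAut Q a :
  Q \subset S -> fully_normalized F Q -> a \in fAut F Q -> conj_mod Q a.
Proof.
move=> sQS nQ Aa; have [_ sylQ] := satF.1 Q sQS nQ.
have /subsetP/(_ a Aa) := @Sylow_mul_p_residual _ _ (fAut_group F sQS)
  (conj_aut Q @* 'N_S(Q))%G p_pr sylQ.
case/mulsgP=> _ c /morphimP[s Ns /setIP[Ss _] ->] Oc ->.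
exists s => // x Qx; rewrite permM norm_conj_autE //.
have Qxs : x ^ s \in Q by rewrite memJ_norm.
have cxs := mem_hyperfocal sQS Oc Qxs.
have /subsetP/(_ c Oc)/fAutP[_ Fc] : p_residual p (fAut F Q) \subset fAut F Q.
  pose A := fAut_group F sQS.
  by apply: (@p_residual_sub p _ A A); rewrite ?normal_refl ?indexgg.
have Sc : c (x ^ s) \in S by rewrite (subsetP sQS) ?(fhom_img Fc).
apply/esym/eq_cosetP; rewrite ?(subsetP sSN) // ?(subsetP sQS) //.
exact: (subsetP sNT).
Qed.

(** Induction on [#|S| - #|P|]. Both [P] and [R = f(P)] are isomorphic to a fully normalized [Q] by
    maps that extend to normalizers; the induction hypothesis covers these, and what is left of [f]
    is an automorphism of [Q]. *)
Lemma fhom_conj_mod P f : fhom F P S f -> conj_mod P f.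
Proof.
have [m lem] := ubnP (#|S| - #|P|); elim: m => // m IHm in P f lem *.
move=> Ff; have sPS := fhom_dom Ff.
have [ePS | neqPS] := eqVneq P S.
  rewrite ePS in Ff *.
  have nS : fully_normalized F S.
    move=> Q _; rewrite subset_leq_card // subsetI subsetIl.
    exact: subset_trans (subsetIl _ _) (normG S).
  have [a Aa af] := fAut_of_fhom Ff.
  have [s Ss sa] := conj_mod_fAut (subxx S) nS Aa.
  by exists s => // x Sx; rewrite -af ?sa.
pose R := (fhom_morphism Ff @* P)%G.
have fPR : f @: P = R by rewrite /= morphimEdom.
have isoR := fhom_hom_iso Ff fPR.
have sRS : R \subset S by have [/fhom_cod] := isoR.
have [Q PQ nQ] := ex_fully_normalized F sPS.
have [k isok] := PQ; have [Fk _] := isok; have sQS := fhom_cod Fk.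
have [g Fg gPQ] := ext_to_normalized satF pS nQ Fk (hom_iso_img isok).
have [k' isok'] : fconj F R Q.
  by apply: fconj_trans PQ; apply: fconj_sym; exists f.
have [Fk' _] := isok'.
have [g' Fg' gRQ] := ext_to_normalized satF pS nQ Fk' (hom_iso_img isok').
have cPR : #|P| = #|R| by apply: (@fconj_card _ _ F); exists f.
(* Proper subgroups of a p-group are smaller than their normalizers. *)
have ltN (M : {group gT}) : M \subset S -> #|M| = #|P| -> #|S| - #|'N_S(M)| < m.
  move=> sMS eMP; rewrite -ltnS; apply: leq_trans lem; rewrite ltnS.
  have ltMS : M \proper S.
    by rewrite properEcard sMS eMP ltn_neqAle subset_leq_card // andbT;
       apply: contraNneq neqPS => cPS; rewrite -val_eqE eqEcard sPS cPS /=.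
  apply: ltn_sub2l; first by rewrite -eMP proper_card.
  by rewrite -eMP proper_card // nilpotent_proper_norm // (pgroup_nil pS).
have [s Ss sg] := IHm _ _ (ltN P sPS (erefl _)) Fg.
have [s' Ss' sg'] := IHm _ _ (ltN R sRS (esym cPR)) Fg'.
have sPN : P \subset 'N_S(P) by rewrite subsetI sPS normG.
have sRN : R \subset 'N_S(R) by rewrite subsetI sRS normG.
have FgP := fhom_restr Fg sPN; have FgR := fhom_restr Fg' sRN.
have [FgP' [g1 [Fg1 gK Kg]]] := fhom_hom_iso FgP gPQ.
have [FgR' _] := fhom_hom_iso FgR gRQ.
have [FfR _] := isoR.
(* The loop from [Q] to [P] to [R] and back to [Q] is an automorphism of [Q]. *)
have Fh := fhom_comp (fhom_comp Fg1 FfR) FgR'.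
have [a Aa ah] := fAut_of_fhom Fh.
have [u Su ua] := conj_mod_fAut sQS nQ Aa.
(* On [P], [f] is [g], then [a], then the inverse of [g']; modulo [T] these are conjugations by [s],
   [u] and [s'^-1]. *)
exists (s * u * s'^-1) => [|x Px]; first by rewrite !groupM ?groupV.
have Rfx := fhom_img FfR Px; have Qgx := fhom_img FgP' Px.
have Sx := subsetP sPS x Px; have Sfx := subsetP sRS _ Rfx.
have Sgx := subsetP sQS _ Qgx.
have := ua _ Qgx; rewrite ah //= gK // sg' ?(subsetP sRN) //.
rewrite [in RHS]cosetJ // sg ?(subsetP sPN) // -cosetJ ?groupJ // => efx.
rewrite -[f x](conjgK s') [in LHS]cosetJ ?groupJ ?groupV // efx.
by rewrite -cosetJ ?groupJ ?groupV // !conjgM.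
Qed.

End Mod.
End ModHyperfocal.

(** * The series *)

Section Series.
Variables (p : nat) (gT : finGroupType) (S : {group gT}) (F : fusion_system S).
Hypotheses (p_pr : prime p) (pS : p.-group S).
Implicit Types P Q R : {group gT}.
Local Notation T := (fseries p F).

Lemma fseries_sub n : T n \subset S.
Proof. by have [] := fseries_closed p F n. Qed.

Lemma fseries_fhom n P f t : fhom F P S f -> t \in P -> t \in T n -> f t \in T n.
Proof.
move=> Ff Pt Tt; have [_] := fseries_closed p F n; apply=> //.
by apply: (fhom_restr Ff); rewrite cycle_subG.
Qed.

Lemma fseries_expp n t : t \in T n -> t ^+ p \in T n.+1.
Proof.
by move=> Tt; apply/(subsetP (joing_subl _ _))/mem_gen/imset_f.
Qed.

Lemma fseries_fhom_comm n P f t :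
  fhom F P S f -> t \in P -> t \in T n -> t^-1 * f t \in T n.+1.
Proof.
move=> Ff Pt Tt; apply: (subsetP (joing_subr _ _)).
have sVP : <[t^-1]> \subset P by rewrite cycle_subG groupV.
have -> : t^-1 * f t = t^-1 * f (t^-1)^-1 by rewrite invgK.
apply: fcommP; first by rewrite groupV.
apply: (fhom_corestr (fhom_restr Ff sVP) (fseries_sub n)) => x tx.
apply: (fseries_fhom Ff); first exact: (subsetP sVP).
by rewrite (subsetP _ x tx) // cycle_subG groupV.
Qed.

Lemma fseriesS n : T n.+1 \subset T n.
Proof.
rewrite join_subG !gen_subG; apply/andP; split; apply/subsetP=> x.
  by case/imsetP=> t Tt ->; rewrite groupX.
rewrite inE => /exists_inP[t Tt /existsP[f /andP[Ff /eqP->]]].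
by rewrite groupM // (fhom_img Ff) ?groupV ?cycle_id.
Qed.

Lemma fseries_le m n : m <= n -> T n \subset T m.
Proof.
move/subnK <-; elim: (n - m) => // k IHk.
exact: subset_trans (fseriesS _) IHk.
Qed.

Lemma fAut_fhomS P a : a \in fAut F P -> fhom F P S a.
Proof.
case/fAutP=> _ Fa; have sPS := fhom_dom Fa.
by apply: (fhom_corestr Fa) => // x Px; rewrite (subsetP sPS) ?(fhom_img Fa).
Qed.

(** The kernel of the action of Aut_F(P) on the classes of [P] modulo [T n]. *)
Definition fAut_centralizer n P : {set {perm gT}} :=
  [set a in fAut F P | [forall x in P, x^-1 * a x \in T n]].

Lemma fAut_centralizerP n P a :
  reflect (a \in fAut F P /\ {in P, forall x, coset (T n) (a x) = coset (T n) x})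
          (a \in fAut_centralizer n P).
Proof.
have sSN := normal_norm (fseries_normal p F n).
have NP x : a \in fAut F P -> x \in P -> x \in 'N(T n) /\ a x \in 'N(T n).
  case/fAutP=> _ Fa Px; have sPS := fhom_dom Fa.
  by split; rewrite (subsetP sSN) // (subsetP sPS) ?(fhom_img Fa).
apply: (iffP setIdP) => [[Aa /forall_inP xT] | [Aa xT]]; split=> //.
  by move=> x Px; have [Nx Nax] := NP x Aa Px; apply/esym/eq_cosetP; rewrite ?xT.
apply/forall_inP=> x Px; have [Nx Nax] := NP x Aa Px.
by apply/eq_cosetP; rewrite ?xT.
Qed.

Lemma fAut_centralizer_group_set n P (sPS : P \subset S) :
  group_set (fAut_centralizer n P).
Proof.
have gA := fAut_group_set F sPS.
apply/group_setP; split=> [|a b /fAut_centralizerP[Aa aT] /fAut_centralizerP[Ab bT]].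
  apply/fAut_centralizerP; split; first exact: (group1 (Group gA)).
  by move=> x _; rewrite perm1.
apply/fAut_centralizerP; split; first exact: (@groupM _ (Group gA)).
have [_ Fa] := fAutP Aa.
by move=> x Px; rewrite permM bT ?aT ?(fhom_img Fa).
Qed.

(** If [b] is trivial modulo [T n], then b(x) = x t with t in [T n], and [b] fixes t modulo
    [T n.+1]. So b^i(x) is x t^i modulo [T n.+1], and t^p lies in [T n.+1]. *)
Lemma expp_fAut_centralizer n P a :
  a \in fAut F P -> a ^+ (p ^ n) \in fAut_centralizer n P.
Proof.
move=> Aa; have [_ Fa] := fAutP Aa; have sPS := fhom_dom Fa.
pose A := fAut_group F sPS.
elim: n => [|n IHn].
  rewrite expn0 expg1 inE Aa; apply/forall_inP=> x Px.
  by rewrite groupM ?groupV ?(subsetP sPS) ?(fhom_img Fa).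
rewrite expnSr expgM; set b := a ^+ _ in IHn *.
case/fAut_centralizerP: (IHn) => Ab bT; have [_ Fb] := fAutP Ab.
apply/fAut_centralizerP; split; first exact: (@groupX _ A).
move=> x Px; have sSN := subset_trans sPS (normal_norm (fseries_normal p F n.+1)).
pose t := x^-1 * b x.
have Pt : t \in P by rewrite groupM ?groupV // (fhom_img Fb).
have Tt : t \in T n by move: IHn; rewrite inE Ab => /forall_inP/(_ x Px).
have AbX i : b ^+ i \in fAut F P by exact: (@groupX _ A).
have FbX i := fAut_fhomS (AbX i).
have biP i y : y \in P -> (b ^+ i) y \in P.
  by case/fAutP: (AbX i) => _ /fhom_img; apply.
have biT i : coset (T n.+1) ((b ^+ i) t) = coset (T n.+1) t.
  apply/esym/eq_cosetP; rewrite ?(subsetP sSN) ?biP //.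
  exact: fseries_fhom_comm (FbX i) Pt Tt.
have biX i : coset (T n.+1) ((b ^+ i) x) = coset (T n.+1) x * coset (T n.+1) t ^+ i.
  elim: i => [|i IHi]; first by rewrite expg0 perm1 mulg1.
  rewrite expgS permM -[b x](mulKVg x) -/t (fhomM (FbX i)) //.
  by rewrite morphM ?(subsetP sSN) ?biP //= biT IHi expgSr mulgA.
rewrite biX -morphX ?(subsetP sSN) //= [coset _ (t ^+ p)]coset_id ?mulg1 //.
exact: fseries_expp.
Qed.

(** The centralizer is normal, and the quotient by it has exponent dividing p^n. By Cauchy's theorem
    its index is a power of p, so it contains the residual. *)
Lemma p_residual_fAut_centralizer n P : P \subset S ->
  p_residual p (fAut F P) \subset fAut_centralizer n P.
Proof.
move=> sPS; pose A := fAut_group F sPS.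
pose C := Group (fAut_centralizer_group_set n sPS).
have sSN := subset_trans sPS (normal_norm (fseries_normal p F n)).
have sCA : C \subset A by apply/subsetP=> a /fAut_centralizerP[].
have nCA : C <| A.
  rewrite /normal sCA; apply/subsetP=> b Ab; rewrite inE.
  apply/subsetP=> _ /imsetP[a /fAut_centralizerP[Aa aT] ->].
  apply/fAut_centralizerP; split; first exact: (@groupJ _ A).
  move=> x Px; rewrite conjgE !permM.
  have [[_ Fb] [_ FbV] [_ Fa]] := And3 (fAutP Ab) (fAutP (groupVr (Ab : b \in A))) (fAutP Aa).
  set y := (b^-1)%g x; have Py : y \in P by exact: (fhom_img FbV).
  have -> : x = b y by rewrite /y permKV.
  have Pay : a y \in P by exact: (fhom_img Fa).
  apply/esym/eq_cosetP; rewrite ?(subsetP sSN) ?(fhom_img Fb) //.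
  rewrite -(fhomV Fb) // -(fhomM Fb) ?groupV //.
  apply: (fseries_fhom (fAut_fhomS Ab)); first by rewrite groupM ?groupV.
  by apply/eq_cosetP; rewrite ?(subsetP sSN) ?aT.
apply: (@p_residual_sub p _ A C nCA).
rewrite -card_quotient ?normal_norm //; apply/pgroupP=> q q_pr qdvd.
have [xb] := Cauchy q_pr qdvd; case/morphimP=> a Na Aa -> oa.
have : (coset C a) ^+ (p ^ n) = 1.
  by rewrite -morphX //= coset_id //; apply: expp_fAut_centralizer.
move/eqP; rewrite -order_dvdn oa => qpn.
by move: qpn; rewrite Euclid_dvdX // => /andP[]; rewrite inE -dvdn_prime2.
Qed.

Lemma hyperfocal_sub_fseries n : hyperfocal p F \subset T n.
Proof.
rewrite gen_subG; apply/bigcupsP=> P sPS; rewrite gen_subG.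
apply/subsetP=> _ /imset2P[x a Px Oa ->].
have /(subsetP (p_residual_fAut_centralizer n sPS)) := Oa.
by rewrite inE => /andP[_ /forall_inP->].
Qed.

Hypothesis satF : saturated p F.

(** Modulo the hyperfocal subgroup [N], fusion is conjugation in [S], so stationarity says that T/N
    is generated by [T/N, S/N] and the Frattini subgroup of T/N. Hence T/N = [T/N, S/N], which
    nilpotence of S/N allows only for T/N trivial. *)
Lemma fseries_stationary n : T n.+1 = T n -> T n :=: hyperfocal p F.
Proof.
move=> eT; pose N := <<hyperfocal p F>>%G.
have eN : N :=: hyperfocal p F by rewrite /= genGid.
have sNT : N \subset T n by rewrite eN hyperfocal_sub_fseries.
have nNS : N <| S by rewrite /normal eN; exact: hyperfocal_normal.
have nTS := normal_norm (fseries_normal p F n).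
have sSN := normal_norm nNS; have sTS := fseries_sub n.
have sTN := subset_trans sTS sSN.
apply/eqP; rewrite -eN eqEsubset sNT andbT -quotient_sub1 // subG1.
have nilS : nilpotent (S / N) by rewrite (pgroup_nil (quotient_pgroup _ pS)).
have pT : p.-group (T n / N) by rewrite quotient_pgroup // (pgroupS sTS).
apply/idPn=> ntT; have nST : S / N \subset 'N_(S / N)(T n / N).
  by rewrite subsetI subxx quotient_norms.
have := nil_comm_properl nilS (quotientS N sTS) ntT nST.
suffices -> : [~: T n / N, S / N] = T n / N by rewrite properxx.
rewrite -[LHS]genGid.
apply: Phi_nongen; apply/eqP; rewrite eqEsubset join_subG Phi_sub /=.
rewrite commg_subl quotient_norms ?(subset_trans _ nTS) //=.
rewrite sub_quotient_pre // -{1}eT join_subG !gen_subG; apply/andP; split.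
  apply/subsetP=> _ /imsetP[t Tt ->]; rewrite mem_morphpre ?groupX ?(subsetP sTN) //=.
  rewrite morphX ?(subsetP sTN) //=; apply: (subsetP (joing_subl _ _)).
  rewrite (Phi_joing pT); apply: (subsetP (joing_subr _ _)).
  by rewrite -[p in _ ^+ p]expn1 Mho_p_elt ?mem_quotient // (mem_p_elt pT) ?mem_quotient.
apply/subsetP=> y; rewrite inE => /exists_inP[t Tt /existsP[f /andP[Ff /eqP->]]].
have [sn ss] : T n \subset S /\ <[t]> \subset S by rewrite cycle_subG (subsetP sTS).
have FfS : fhom F <[t]> S f.
  by apply: (fhom_corestr Ff) => // x tx; rewrite (subsetP sTS) ?(fhom_img Ff).
have sNT' : hyperfocal p F \subset N by rewrite -eN.
have [s Ss fs] := fhom_conj_mod p_pr pS satF nNS sNT' FfS.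
have St : t \in S by rewrite (subsetP sTS).
have ft : f t^-1 \in S by rewrite (fhom_img FfS) ?groupV ?cycle_id.
rewrite mem_morphpre /= ?groupM ?(subsetP sSN) //.
rewrite morphM ?(subsetP sSN) //= fs ?groupV ?cycle_id // -morphM ?(subsetP sSN) ?groupJ ?groupV //=.
have -> : t * t^-1 ^ s = [~ t^-1, s] by rewrite commgEl invgK.
rewrite morphR ?(subsetP sSN) ?groupV //=.
by apply/(subsetP (joing_subr _ _))/mem_commg; rewrite mem_quotient ?groupV.
Qed.

End Series.

(** * Marks and the characteristic biset *)

Section Marks.
Variables (gT : finGroupType) (G : {group gT}).
Implicit Types (D E B : {group gT}) (X : {set gT}).

(** An entry of Burnside's table of marks, for the transitive G-set of right cosets of [E]. *)
Definition mark E X : nat := #|'Fix_(rcosets E G | 'Rs)(X)|.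

Lemma mark_gen E X : mark E <<X>> = mark E X.
Proof. by rewrite /mark afix_gen. Qed.

Lemma mark_neq0 E X : mark E X != 0 -> exists2 g, g \in G & X \subset E :^ g.
Proof.
rewrite -lt0n => /card_gt0P[_ /setIP[/rcosetsP[g Gg ->]]].
by rewrite sub_afixRs_norms; exists g.
Qed.

Lemma markJ E X g : g \in G -> mark E (X :^ g) = mark E X.
Proof.
have le x Y : x \in G -> mark E Y <= mark E (Y :^ x).
  move=> Gx; rewrite /mark -(card_imset _ (act_inj 'Rs x)).
  apply/subset_leq_card/subsetP=> _ /imsetP[_ /setIP[/rcosetsP[h Gh ->] fixY] ->].
  rewrite /= rcosetE -rcosetM; apply/setIP; split.
    by apply/rcosetsP; exists (h * x); rewrite ?groupM.
  by rewrite sub_afixRs_norms conjsgM conjSg -sub_afixRs_norms.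
move=> Gg; apply/eqP; rewrite eqn_leq le // andbT.
by rewrite -[in leqRHS](conjsgK g X) le ?groupV.
Qed.

Lemma mark_id E : E \subset G -> mark E E = #|'N_G(E) : E|.
Proof. by move=> sEG; rewrite /mark afixRs_rcosets. Qed.

Lemma mark_card_gt E D : #|E| < #|D| -> mark E D = 0.
Proof.
move=> ltED; apply/eqP/idPn=> /mark_neq0[g _ /subset_leq_card].
by rewrite cardJg leqNgt ltED.
Qed.

Lemma mark_card_eq E D :
  #|E| = #|D| -> mark E D != 0 -> exists2 g, g \in G & D :=: E :^ g.
Proof.
move=> eED /mark_neq0[g Gg sDE]; exists g => //.
by apply/eqP; rewrite eqEcard sDE cardJg eED /=.
Qed.

(* Cauchy-Frobenius count of the orbits of [B] on the points fixed by [D]. *)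
Lemma dvdn_sum_mark E D B :
  B \subset 'N_G(D) -> #|B| %| \sum_(b in B) mark E (b |: D).
Proof.
rewrite subsetI => /andP[sBG nDB].
have actB : [acts B, on 'Fix_(rcosets E G | 'Rs)(D) | 'Rs].
  apply: actsI; first exact: subset_trans sBG (actsRs_rcosets E G).
  exact: acts_fix_norm.
rewrite (eq_bigr (fun b => #|'Fix_('Fix_(rcosets E G | 'Rs)(D) | 'Rs)[b]|)).
  by rewrite (Frobenius_Cauchy actB) dvdn_mull.
move=> b _; rewrite /mark; congr #|pred_of_set _|.
by apply/setP=> C; rewrite setUC afixU !inE andbA.
Qed.

Local Open Scope ring_scope.
Import GRing.Theory.

(** The mark of a virtual G-set, in which the orbit type of [E] has multiplicity [c E]. *)
Definition vmark (c : {group gT} -> int) X : int :=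
  \sum_(E : {group gT}) c E * (mark E X)%:Z.

Lemma vmark_gen c X : vmark c <<X>> = vmark c X.
Proof. by apply: eq_bigr => E _; rewrite mark_gen. Qed.

Lemma vmarkJ c X g : g \in G -> vmark c (X :^ g) = vmark c X.
Proof. by move=> Gg; apply: eq_bigr => E _; rewrite markJ. Qed.

Lemma dvdz_sum_vmark c D B :
  B \subset 'N_G(D) -> (#|B| %| \sum_(b in B) vmark c (b |: D))%Z.
Proof.
move=> nDB; rewrite exchange_big /=; apply: rpred_sum => E _.
by rewrite -mulr_sumr dvdz_mull // -(big_morph Posz PoszD (erefl _)) dvdzE dvdn_sum_mark.
Qed.

End Marks.

Section ConjRep.
Variables (gT : finGroupType) (G : {group gT}).
Implicit Types E : {group gT}.

(** The choice depends only on the orbit; the default is never reached, as the orbit contains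
    [E]. *)
Definition conj_rep E : {group gT} := odflt E [pick R in orbit 'JG G E].

Lemma conj_repP E : exists2 g, g \in G & conj_rep E = (E :^ g)%G.
Proof.
rewrite /conj_rep; case: pickP => [R /orbitP[g Gg <-] | /(_ E)].
  by exists g.
by rewrite orbit_refl.
Qed.

Lemma conj_repJ E g : g \in G -> conj_rep (E :^ g)%G = conj_rep E.
Proof.
move=> Gg; rewrite /conj_rep.
have -> : orbit 'JG G (E :^ g)%G = orbit 'JG G E.
  exact: (orbit_act 'JG E Gg).
by case: pickP => // /(_ E); rewrite orbit_refl.
Qed.

End ConjRep.

(** * Subgroups of S x S that are graphs of morphisms *)

Section FusionGraphs.
Variables (gT : finGroupType) (S : {group gT}) (F : fusion_system S).
Implicit Types (P Q A : {group gT}) (D E B : {group gT * gT}).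
Local Notation SS := (setX_group S S).

Definition proj1 D : {group gT} := (fst_morphism gT gT @* D)%G.
Definition proj2 D : {group gT} := (snd_morphism gT gT @* D)%G.

Lemma mem_proj1 D z : z \in D -> z.1 \in proj1 D.
Proof. by move=> Dz; apply: mem_morphim; rewrite ?inE. Qed.

Lemma mem_proj2 D z : z \in D -> z.2 \in proj2 D.
Proof. by move=> Dz; apply: mem_morphim; rewrite ?inE. Qed.

Lemma proj1P D x : reflect (exists y, (x, y) \in D) (x \in proj1 D).
Proof.
apply: (iffP morphimP) => [[[x1 y] _ Dz /= ->] | [y Dz]]; first by exists y.
by exists (x, y); rewrite ?inE.
Qed.

Lemma proj2P D y : reflect (exists x, (x, y) \in D) (y \in proj2 D).
Proof.
apply: (iffP morphimP) => [[[x y1] _ Dz /= ->] | [x Dz]]; first by exists x.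
by exists (x, y); rewrite ?inE.
Qed.

Lemma proj1S D E : D \subset E -> proj1 D \subset proj1 E.
Proof. exact: morphimS. Qed.

(** The domain of [h] is exactly the first projection, so [D] is the whole graph of [h], a twisted
    diagonal subgroup. *)
Definition fusion_graph D : bool :=
  [exists h : {ffun gT -> gT},
     fhom F (proj1 D) S h && [forall z in D, z.2 == h z.1]].

Lemma fusion_graphP D :
  reflect (exists2 h, fhom F (proj1 D) S h & {in D, forall z, z.2 = h z.1})
          (fusion_graph D).
Proof.
apply: (iffP existsP) => [[h /andP[Fh /forall_inP hD]] | [h Fh hD]].
  by exists h => // z /hD/eqP.
exists [ffun x => h x]; rewrite (@fhom_ext _ _ F _ _ _ h) => [|x _].
  by rewrite Fh; apply/forall_inP=> z Dz; rewrite ffunE hD.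
by rewrite ffunE.
Qed.

Lemma fusion_graphS D E : D \subset E -> fusion_graph E -> fusion_graph D.
Proof.
move=> sDE /fusion_graphP[h Fh hE]; apply/fusion_graphP; exists h.
  exact: fhom_restr Fh (proj1S sDE).
by move=> z Dz; rewrite hE // (subsetP sDE).
Qed.

Lemma fusion_graph_sub D : fusion_graph D -> D \subset SS.
Proof.
case/fusion_graphP=> h Fh hD; apply/subsetP=> -[x y] Dz; rewrite inE /=.
have Px := mem_proj1 Dz; rewrite (subsetP (fhom_dom Fh)) //=.
by have /= -> := hD _ Dz; rewrite (fhom_img Fh).
Qed.

(** Conjugation by [(a, b)] composes [h] with conjugation by [a^-1] before and by [b] after. *)
Lemma fusion_graphJ D g : g \in SS -> fusion_graph D -> fusion_graph (D :^ g)%G.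
Proof.
case: g => a b; rewrite inE /= => /andP[Sa Sb] /fusion_graphP[h Fh hD].
have JD x y : (x, y) \in (D :^ (a, b))%G -> (x ^ a^-1, y ^ b^-1) \in D.
  by rewrite /= mem_conjg.
have sPS : proj1 (D :^ (a, b))%G \subset S.
  apply/subsetP=> x /proj1P[y /JD/mem_proj1 /(subsetP (fhom_dom Fh))].
  by rewrite /= groupJr // groupV.
apply/fusion_graphP; exists ((conjg^~ b \o h) \o conjg^~ a^-1); last first.
  by move=> [x y] /JD/hD /= <-; rewrite conjgKV.
apply: (@fhom_comp _ _ _ _ (proj1 D)).
  apply: fhom_conj; rewrite ?(fhom_dom Fh) ?groupV //.
  apply/subsetP=> _ /imsetP[x /proj1P[y /JD Dxy] ->].
  exact: mem_proj1 Dxy.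
by apply: (fhom_comp Fh); apply: fhom_conj; rewrite ?conjGid.
Qed.

Lemma proj2J D a b : proj2 (D :^ (a, b))%G = (proj2 D :^ b)%G.
Proof.
apply/val_inj/setP=> y; rewrite /= mem_conjg.
apply/idP/idP=> [/proj2P[x] | /proj2P[x Dxy]].
  by rewrite /= mem_conjg => /mem_proj2.
apply/proj2P; exists (x ^ a); rewrite /= mem_conjg.
have -> : (x ^ a, y) ^ (a, b)^-1 = ((x ^ a) ^ a^-1, y ^ b^-1) by [].
by rewrite conjgK.
Qed.

Lemma card_proj1 D : fusion_graph D -> #|proj1 D| = #|D|.
Proof.
case/fusion_graphP=> h Fh hD; rewrite /= morphimEsub ?subsetT // card_in_imset //.
move=> [x y] [x' y'] Dz Dz' /= exx.
by have /= -> := hD _ Dz; have /= -> := hD _ Dz'; rewrite exx.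
Qed.

Lemma card_proj2 D : fusion_graph D -> #|proj2 D| = #|D|.
Proof.
case/fusion_graphP=> h Fh hD; rewrite /= morphimEsub ?subsetT // card_in_imset //.
move=> [x y] [x' y'] Dz Dz' /= eyy; congr (_, _) => //.
apply: (fhom_injective Fh); rewrite ?(mem_proj1 Dz) ?(mem_proj1 Dz') //.
by have /= <- := hD _ Dz; have /= <- := hD _ Dz'.
Qed.

Lemma proj2_sub D : fusion_graph D -> proj2 D \subset S.
Proof.
move=> gD; apply/subsetP=> y /proj2P[x /(subsetP (fusion_graph_sub gD))].
by rewrite inE => /andP[].
Qed.

Lemma ex_graph P f : fhom F P S f ->
  exists D, [/\ fusion_graph D, proj1 D = P &
                forall z, (z \in D) = (z.1 \in P) && (z.2 == f z.1)].
Proof.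
move=> Ff; pose d := [set z : gT * gT | (z.1 \in P) && (z.2 == f z.1)].
have gd : group_set d.
  apply/group_setP; split=> [|[x y] [x' y']]; first by rewrite inE group1 (fhom1 Ff) /=.
  rewrite !inE /= => /andP[Px /eqP->] /andP[Px' /eqP->].
  by rewrite groupM //= (fhomM Ff).
have eP : proj1 (Group gd) = P.
  apply/val_inj/setP=> x; apply/proj1P/idP=> [[y] | Px].
    by rewrite inE => /andP[].
  by exists (f x); rewrite inE Px /=.
exists (Group gd); split=> //; last by move=> z; rewrite inE.
apply/fusion_graphP; exists f; first by rewrite eP.
by move=> z; rewrite inE => /andP[_ /eqP].
Qed.

(** Moving the first coordinate by [e] precomposes [h] with the inverse of [e]. This is how two
    graphs with the same second projection are compared. *)
Lemma fusion_graph_transport D D' A e :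
    fhom F A S e -> proj1 D \subset A ->
    D' :=: [set (e z.1, z.2) | z in D] ->
  fusion_graph D = fusion_graph D' /\ proj2 D = proj2 D'.
Proof.
move=> Fe sDA eD'.
have memD' x y : (x, y) \in D -> (e x, y) \in D'.
  by move=> Dz; rewrite eD'; apply/imsetP; exists (x, y).
split; last first.
  apply/val_inj/setP=> y; apply/proj2P/proj2P=> [[x /memD' D'z] | [x]].
    by exists (e x).
  by rewrite eD' => /imsetP[[x1 y1] Dz [_ ->]]; exists x1.
have FeD := fhom_restr Fe sDA.
have imD : e @: proj1 D = proj1 D'.
  apply/setP=> x; apply/imsetP/proj1P=> [[x1 /proj1P[y /memD' D'z] ->] | [y]].
    by exists y.
  by rewrite eD' => /imsetP[[x1 y1] /mem_proj1 Dz [-> _]]; exists x1.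
have [Fe' [j [Fj ej je]]] := fhom_hom_iso FeD imD.
apply/fusion_graphP/fusion_graphP=> [[h Fh hD] | [h Fh hD']].
  exists (h \o j); first exact: fhom_comp Fj Fh.
  move=> z; rewrite eD' => /imsetP[z1 Dz1 ->] /=.
  by rewrite ej ?mem_proj1 // hD.
exists (h \o e); first exact: fhom_comp Fe' Fh.
by move=> [x y] /memD'/hD'.
Qed.

End FusionGraphs.

(** * Stability of marks and the congruence between them *)

Section CharacteristicBiset.
Variables (p : nat) (gT : finGroupType) (S : {group gT}) (F : fusion_system S).
Hypotheses (p_pr : prime p) (pS : p.-group S) (satF : saturated p F).
Implicit Types (P Q A : {group gT}) (D E B : {group gT * gT}).
Implicit Types c : {group gT * gT} -> int.
Local Notation SS := (setX_group S S).
Local Open Scope ring_scope.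
Local Open Scope group_scope.
Import GRing.Theory.

Definition fusion_graph_supported c := forall E, c E != 0 -> fusion_graph F E.

(** Two graphs with the same second projection differ by an F-isomorphism of their first
    projections, so this is F-stability in the first variable, down to order [k]. *)
Definition stable_above k c := forall D D',
  fusion_graph F D -> fusion_graph F D' -> (k <= #|D|)%N -> proj2 D = proj2 D' ->
  vmark SS c D = vmark SS c D'.

(** A fixed point would place [D] inside a conjugate of a graph, and subgroups of graphs are
    graphs. *)
Lemma vmark_nongraph c D :
  fusion_graph_supported c -> ~~ fusion_graph F D -> vmark SS c D = 0.
Proof.
move=> supc ngD; apply: big1 => E _.
have [-> | /supc gE] := eqVneq (c E) 0; first by rewrite mul0r.
have [-> | /mark_neq0[g SSg sDE]] := eqVneq (mark SS E D) 0%N; first by rewrite mulr0.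
by rewrite (fusion_graphS sDE (fusion_graphJ SSg gE)) in ngD.
Qed.

(* [D0] is the graph of the inverse of an isomorphism from [Q] to a fully
   normalized subgroup that extends to [N_S(Q)]. *)
Lemma vmark_congr c k Q :
    fusion_graph_supported c -> stable_above k.+1 c -> Q \subset S -> #|Q| = k ->
  exists D0, forall D, fusion_graph F D -> proj2 D = Q ->
    (#|'N_SS(D) : D|%g %| vmark SS c D - vmark SS c D0)%Z.
Proof.
move=> supc stc sQS cQ.
have [P0 QP0 nP0] := ex_fully_normalized F sQS.
have [k0 isok] := QP0; have [Fk0 _] := isok; have sP0S := fhom_cod Fk0.
have [g0 Fg0 g0Q] := ext_to_normalized satF pS nP0 Fk0 (hom_iso_img isok).
have sQN : Q \subset 'N_S(Q) by rewrite subsetI sQS normG.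
have [Fg0Q _] := fhom_hom_iso (fhom_restr Fg0 sQN) g0Q.
pose d0 := [set z : gT * gT | (z.2 \in Q) && (z.1 == g0 z.2)].
have gd0 : group_set d0.
  apply/group_setP; split=> [|[x y] [x' y']]; first by rewrite inE group1 (fhom1 Fg0) /=.
  rewrite !inE /= => /andP[Qy /eqP->] /andP[Qy' /eqP->].
  by rewrite groupM //= (fhomM Fg0Q).
exists (Group gd0) => D gD pD.
have sDSS := fusion_graph_sub gD.
have /fusion_graphP[h Fh hD] := gD.
pose B := 'N_SS(D)%G.
have sBSS : B \subset SS by exact: subsetIl.
have nDB : B \subset 'N(D) by exact: subsetIr.
have sDB : D \subset B by rewrite subsetI sDSS normG.
have hQ x : x \in proj1 D -> h x \in Q.
  by case/proj1P=> y Dxy; rewrite -pD -(hD _ Dxy) mem_proj2.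
have hG x : x \in proj1 D -> (x, h x) \in D.
  by case/proj1P=> y Dxy; rewrite -(hD _ Dxy).
(* This isomorphism onto the fully normalized [P0] carries [D] to the reference graph. *)
have Fe : fhom F (proj1 D) P0 (g0 \o h).
  exact: fhom_comp (fhom_corestr Fh sQS hQ) Fg0Q.
have FeS : fhom F (proj1 D) S (g0 \o h).
  by apply: (fhom_corestr Fe) => // x Dx; rewrite (subsetP sP0S) ?(fhom_img Fe).
pose em := fhom_morphism FeS.
have emP : (em @* proj1 D)%G = P0.
  apply/val_inj/eqP; rewrite eqEcard; apply/andP; split.
    by apply/subsetP=> _ /morphimP[x _ Dx ->]; rewrite (fhom_img Fe).
  rewrite /= card_injm ?(card_proj1 gD) -?(fconj_card QP0) ?cQ //.
    by rewrite -(card_proj2 gD) pD cQ.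
  by apply/injmP; exact: fhom_injective Fe.
have [_ satE] := satF; have [cP0 _] := satF.1 P0 sP0S nP0.
have [|e Fe1 eE] := satE _ em FeS; first by rewrite emP.
(* If [(a, b)] normalizes [D], then [h] turns conjugation by [a] into conjugation by [b], and [b]
   normalizes [Q]. Since [g0] is defined on N_S(Q), [g0 b] is the partner of [a]. *)
have sAe : proj1 B \subset extender_group S em.
  apply/subsetP=> a /proj1P[b Bab].
  have [/setXP[/= Sa Sb] Nab] := setIP Bab.
  have habD x : x \in proj1 D -> x ^ a \in proj1 D /\ h (x ^ a) = h x ^ b.
    move/hG=> Dx; have : (x, h x) ^ (a, b) \in D by rewrite memJ_norm.
    rewrite -[_ ^ _]/(x ^ a, h x ^ b) => Dxab.
    by split; [exact: mem_proj1 Dxab | rewrite -(hD _ Dxab)].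
  have Na : a \in 'N(proj1 D).
    by rewrite inE; apply/subsetP=> _ /imsetP[x Dx ->]; case: (habD x Dx).
  have Nb : b \in 'N_S(Q).
    rewrite inE Sb -pD inE; apply/subsetP=> _ /imsetP[y /proj2P[x Dxy] ->].
    have Dx := mem_proj1 Dxy; have [_] := habD x Dx.
    rewrite -(hD _ Dxy) /= => <-.
    by rewrite -[h _]/((x ^ a, h (x ^ a)).2) mem_proj2 // hG //; case: (habD x Dx).
  rewrite /= inE inE Sa Na /=; apply/exists_inP; exists (g0 b).
    rewrite [em @* _](congr1 val emP) inE (fhom_img Fg0) //=.
    rewrite inE; apply/subsetP=> _ /imsetP[y P0y ->].
    have /imsetP[z Qz ->] : y \in g0 @: Q by rewrite g0Q.
    rewrite -(fhomJ Fg0 (subsetP sQN z Qz) Nb); apply: (fhom_img Fg0Q).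
    by rewrite memJ_norm //; case/setIP: Nb.
  apply/forall_inP=> x Dx; have [Dxa hxa] := habD x Dx.
  by rewrite /= hxa (fhomJ Fg0) // (subsetP sQN) // hQ.
have Fe2 := fhom_restr Fe1 sAe.
(* The extended map embeds the normalizer of [D] into that of the reference graph. *)
pose ga (z : gT * gT) := (e z.1, z.2).
have gaM : {in B &, {morph ga : z t / (z * t)%g}}.
  by move=> z t Bz Bt; rewrite /ga /= (fhomM Fe2) ?mem_proj1.
pose gm := Morphism gaM.
have injg : 'injm gm.
  apply/injmP=> -[x y] [x' y'] Bz Bz' [exx ->]; congr (_, _).
  exact: (fhom_injective Fe2) (mem_proj1 Bz) (mem_proj1 Bz') exx.
have gD0 : gm @* D = Group gd0.
  apply/eqP; rewrite eqEcard card_injm //; apply/andP; split.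
    apply/subsetP=> _ /morphimP[z Bz Dz ->].
    rewrite inE /= -pD mem_proj2 //= eE ?mem_proj1 //=.
    by rewrite (hD _ Dz).
  rewrite -(card_proj2 gD) pD; have inj2 : {in d0 &, injective (@snd gT gT)}.
    move=> [x y] [x' y'] /=; rewrite !inE /= => /andP[_ /eqP->] /andP[_ /eqP->].
    by move->.
  rewrite -(card_in_imset inj2); apply: subset_leq_card.
  by apply/subsetP=> _ /imsetP[z zd ->]; move: zd; rewrite inE => /andP[].
have sgB : gm @* B \subset 'N_SS(Group gd0).
  rewrite subsetI -{1}gD0 (subset_trans _ (morphim_norm gm D)) ?andbT.
    apply/subsetP=> _ /morphimP[[x y] Bz _ ->].
    have /(subsetP sBSS)/setXP[_ Sy] := Bz.
    by rewrite inE /= (fhom_img Fe2) ?(mem_proj1 Bz).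
  by rewrite morphimS // subsetIr.
(* The two Cauchy-Frobenius sums over [B] are subtracted term by term: a term with [b] in [D] gives
   the difference of the two marks, all others cancel. *)
have dv1 := dvdz_sum_vmark c (subxx B).
have dv2 := dvdz_sum_vmark c sgB.
have eqs : \sum_(b in gm @* B) vmark SS c (b |: Group gd0) =
           \sum_(b in B) vmark SS c (ga b |: Group gd0).
  by rewrite morphimEdom big_imset //; apply/injmP.
have := rpredB dv1; rewrite card_injm // eqs in dv2 => /(_ _ dv2).
rewrite -sumrB (big_setID D) /= (setIidPr sDB) [X in _ + X]big1 => [|b].
  rewrite addr0 (eq_bigr (fun=> vmark SS c D - vmark SS c (Group gd0))) => [|b Db].
    rewrite sumr_const -(Lagrange sDB) -[_ *+ _]mulr_natl natz PoszM.
    by rewrite dvdz_mul2l // -lt0n cardG_gt0.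
  have gab : ga b \in Group gd0.
    by rewrite -gD0; apply: (mem_morphim gm); rewrite // (subsetP sDB).
  by rewrite !(setUidPr _) ?sub1set.
(* For [b] outside [D] the generated groups exceed order [k]: either both are graphs and stability
   applies, or neither is and both marks vanish. *)
case/setDP=> Bb nDb; apply/eqP; rewrite subr_eq0; apply/eqP.
rewrite -vmark_gen -[RHS]vmark_gen.
pose D' := <<b |: D>>%G; pose D'' := <<ga b |: Group gd0>>%G.
have sD'B : D' \subset B by rewrite gen_subG subUset sub1set Bb.
have eD'' : D'' :=: [set (e z.1, z.2) | z in D'].
  rewrite -[RHS]/(ga @: D') -(morphimEsub gm sD'B) /= morphim_gen.
    by rewrite morphimU morphim_set1 // gD0.
  by rewrite subUset sub1set Bb.
have [eg ep] := fusion_graph_transport Fe2 (proj1S sD'B) eD''.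
have [gD' | ngD'] := boolP (fusion_graph F D').
  apply: (stc D' D'') => //; first by rewrite -eg.
  rewrite -cQ -pD (card_proj2 gD) proper_card // properE gen_subG.
  rewrite (subset_trans _ (subset_gen _)) ?subsetUr //=.
  by rewrite subUset sub1set negb_and nDb.
by rewrite !vmark_nongraph // -eg.
Qed.

End CharacteristicBiset.

(** * Construction of a stable virtual biset by descending order of graphs *)

Section BisetExistence.
Variables (p : nat) (gT : finGroupType) (S : {group gT}) (F : fusion_system S).
Hypotheses (p_pr : prime p) (pS : p.-group S) (satF : saturated p F).
Implicit Types (P Q A : {group gT}) (D E B : {group gT * gT}).
Implicit Types c : {group gT * gT} -> int.
Local Notation SS := (setX_group S S).
Local Open Scope ring_scope.
Local Open Scope group_scope.
Import GRing.Theory.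

Lemma index_normJ D g : g \in SS ->
  #|'N_SS(D :^ g) : D :^ g| = #|'N_SS(D) : D|.
Proof.
move=> SSg; rewrite -(indexJg 'N_SS(D)%G D g); congr #|_ : _|.
by rewrite conjIg normJ conjGid.
Qed.

(** Marks are triangular: adding orbits of type [E] with [#|E| = k] leaves the marks of larger
    groups alone and, at order [k], changes only those of conjugates of [E], by multiples of |N(E) :
    E|. The congruence [vmark_congr] says that the required changes are such multiples. *)
Lemma stable_extend c k :
    fusion_graph_supported F c -> stable_above F k.+1 c ->
  exists c', [/\ fusion_graph_supported F c', stable_above F k c' &
                 forall E, #|E| != k -> c' E = c E].
Proof.
move=> supc stc.
have /fin_all_exists[t0 t0P] : forall Q, exists t0 : int, Q \subset S -> #|Q| = k ->
    forall D, fusion_graph F D -> proj2 D = Q ->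
    (#|'N_SS(D) : D| %| vmark SS c D - t0)%Z.
  move=> Q; have [/andP[sQS /eqP cQ] | nQ] := boolP ((Q \subset S) && (#|Q| == k)).
    have [D0 DP] := vmark_congr pS satF supc stc sQS cQ.
    by exists (vmark SS c D0) => _ _ D gD pD; apply: DP.
  by exists 0 => sQS cQ; case/negP: nQ; rewrite sQS cQ eqxx.
(* Passing to a representative makes the target value constant on S-classes of second
   projections. *)
pose t Q := t0 (conj_rep S Q).
have tP D : fusion_graph F D -> #|D| = k ->
    (#|'N_SS(D) : D| %| vmark SS c D - t (proj2 D))%Z.
  move=> gD cD; have [s Ss es] := conj_repP S (proj2 D).
  pose s1 : gT * gT := (1, s).
  have SSs : s1 \in SS by rewrite inE group1.
  have eD : proj2 (D :^ s1)%G = conj_rep S (proj2 D) by rewrite es proj2J.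
  have gDs := fusion_graphJ SSs gD.
  rewrite /t -eD -(index_normJ D SSs) -(vmarkJ c D SSs).
  apply: (t0P _ (proj2_sub gDs) _ _ gDs (erefl _)).
  by rewrite (card_proj2 gDs) /= cardJg.
(* Only one representative of each class is adjusted, so that no class is corrected twice. *)
pose K E := [&& fusion_graph F E, #|E| == k & conj_rep SS E == E].
pose a E : int := if K E then ((t (proj2 E) - vmark SS c E) %/ #|'N_SS(E) : E|)%Z else 0.
have aK E : a E != 0 -> K E by rewrite /a; case: ifP; rewrite ?eqxx.
exists (fun E => c E + a E)%R; split=> [E | D D' gD gD' | E nEk]; last first.
- rewrite [a E](_ : _ = 0) ?addr0 //; apply/eqP/idPn=> /aK/and3P[_].
  by rewrite (negPf nEk).
- have vE (X : {group gT * gT}) : vmark SS (fun E => c E + a E)%R X =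
      (vmark SS c X + \sum_E a E * (mark SS E X)%:Z)%R.
    by rewrite -big_split; apply: eq_bigr => E _; rewrite mulrDl.
  have cE X : fusion_graph F X -> #|X| = #|proj2 X| by move/card_proj2.
  rewrite leq_eqVlt => /orP[/eqP kD | ltkD] pDD'; last first.
    have gt0 (X : {group gT * gT}) : (k < #|X|)%N -> \sum_E a E * (mark SS E X)%:Z = 0.
      move=> ltkX; apply: big1 => E _.
      have [-> | /aK/and3P[_ /eqP cEk _]] := eqVneq (a E) 0; first by rewrite mul0r.
      by rewrite mark_card_gt ?mulr0 // cEk.
    have ltkD' : (k < #|D'|)%N by rewrite (cE _ gD') -pDD' -(cE _ gD).
    by rewrite !vE !gt0 // (stc D D').
  suffices main (X : {group gT * gT}) : fusion_graph F X -> #|X| = k ->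
      vmark SS (fun E => c E + a E)%R X = t (proj2 X).
    by rewrite !main // ?pDD' // (cE _ gD') -pDD' -(cE _ gD).
  move=> gX cX; have [g SSg eX] := conj_repP SS X.
  pose E0 := conj_rep SS X.
  have KE0 : K E0.
    rewrite /K /E0 {1 2}eX fusion_graphJ //= cardJg cX eqxx /=.
    by rewrite {1}eX conj_repJ // eqxx.
  have pE0 : t (proj2 E0) = t (proj2 X).
    case: g SSg eX => g1 g2 /setXP[_ Sg2] eX.
    by rewrite /t /E0 eX proj2J conj_repJ.
  rewrite vE (bigD1 E0) //= big1 ?addr0 => [|E nE0].
    rewrite /a KE0 -(markJ E0 X SSg) -[X :^ g](congr1 val eX) mark_id; last first.
      by case/and3P: KE0 => /fusion_graph_sub.
    rewrite divzK; last first.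
      case/and3P: KE0 => gE0 /eqP cE0 _.
      by rewrite -rpredN opprB tP.
    by rewrite -(vmarkJ c X SSg) -[X :^ g](congr1 val eX) addrC subrK.
  have [-> | /aK/and3P[gE /eqP cEk /eqP rE]] := eqVneq (a E) 0; first by rewrite mul0r.
  have [-> | nz] := eqVneq (mark SS E X) 0%N; first by rewrite mulr0.
  have [|h SSh eXh] := mark_card_eq _ nz; first by rewrite cEk.
  case/eqP: nE0; rewrite /E0 -{1}rE -(conj_repJ E SSh); congr conj_rep.
  exact/val_inj/esym.
case: (eqVneq (c E) 0) => [-> | /supc //]; rewrite add0r.
by case/aK/and3P.
Qed.

(** The extension step is iterated. Coefficients at order [#|S|] stay fixed, and they determine the
    degree modulo p. *)
Lemma stable_to_bottom c :
    fusion_graph_supported F c -> stable_above F #|S| c ->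
  exists c', [/\ fusion_graph_supported F c', stable_above F 0 c' &
                 forall E, (#|S| <= #|E|)%N -> c' E = c E].
Proof.
move=> supc; elim: {1 3}#|S| (leqnn #|S|) c supc => [|k IHk] lekS c supc stc.
  by exists c; split.
have [c1 [supc1 stc1 ec1]] := stable_extend supc stc.
have [c' [supc' stc' ec']] := IHk (ltnW lekS) c1 supc1 stc1.
exists c'; split=> // E leSE; rewrite ec' // ec1 //.
by rewrite gtn_eqF // (leq_trans lekS).
Qed.

(* The graphs of a complement of [Inn(S)] in [Aut_F(S)]. *)
Lemma ex_top_biset : exists c, [/\ fusion_graph_supported F c,
  stable_above F #|S| c, forall E, c E != 0 -> #|E| = #|S| &
  exists2 m, coprime p m & \sum_(E : {group gT * gT}) c E = m%:Z].
Proof.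
have sSS := subxx S.
pose A := fAut_group F sSS.
have nS : fully_normalized F S.
  move=> Q _; rewrite subset_leq_card // subsetI subsetIl.
  exact: subset_trans (subsetIl _ _) (normG S).
have [_ sylS] := satF.1 S sSS nS.
pose I := (conj_aut S @* 'N_S(S))%G.
have nSS x : x \in S -> x \in 'N_S(S) by move=> Sx; rewrite inE Sx (subsetP (normG S)).
have SNS x : x \in 'N_S(S) -> x \in S by case/setIP.
have sIA : I \subset A := pHall_sub sylS.
have nIA : I <| A.
  rewrite /normal sIA; apply/subsetP=> a Aa; rewrite inE.
  apply/subsetP=> _ /imsetP[_ /morphimP[x Nx Sx ->] ->].
  have [AAa Fa] := fAutP Aa; have Sax : a x \in 'N_S(S) by rewrite nSS ?(fhom_img Fa) ?SNS.
  have Nax : a x \in 'N(S) by case/setIP: Sax.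
  apply/morphimP; exists (a x) => //.
  have Ac : conj_aut S x \in Aut S by apply: (subsetP (Aut_conj_aut S 'N_S(S))); rewrite mem_morphim.
  apply: (eq_Aut (groupJ Ac AAa)) => [|y Sy].
    by apply: (subsetP (Aut_conj_aut S 'N_S(S))); rewrite mem_morphim.
  have Sa'y : a^-1 y \in S by rewrite (Aut_closed (groupVr AAa)).
  rewrite conjgE !permM norm_conj_autE // norm_conj_autE // (fhomJ Fa Sa'y (SNS x Sx)).
  by rewrite permKV.
(* Inn(S) is a normal Sylow subgroup of Aut_F(S), so Schur-Zassenhaus provides the complement
   [K]. *)
have hallI : Hall A I by rewrite (pHall_Hall sylS).
have /splitsP[K /complP[tiIK defA]] := SchurZassenhaus_split hallI nIA.
have sKA : K \subset A by rewrite -defA mulG_subr.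
have FA a : a \in A -> fhom F S S a by case/fAutP.
have /fin_all_exists[gr grP] : forall a : {perm gT}, exists D, a \in A ->
    [/\ fusion_graph F D, proj1 D = S &
        forall z, (z \in D) = (z.1 \in S) && (z.2 == a z.1)].
  move=> a; have [/FA Fa | nAa] := boolP (a \in A); last by exists 1%G.
  by have [D DP] := ex_graph Fa; exists D.
pose c E : int := (#|[set a in K | gr a == E]|)%:Z.
have sum_c (f : {group gT * gT} -> int) : \sum_E c E * f E = \sum_(a in K) f (gr a).
  rewrite [RHS](partition_big gr xpredT) //=; apply: eq_bigr => E _.
  rewrite (eq_bigr (fun=> f E)) => [|a /andP[_ /eqP-> //]].
  rewrite sumr_const -mulr_natl natz /c; congr (Posz _ * _)%R.
  by apply: eq_card => a; rewrite !inE.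
exists c; split.
- move=> E; rewrite /c -[0%R]/(Posz 0) eqz_nat -lt0n => /card_gt0P[a].
  rewrite inE => /andP[Ka /eqP<-].
  by have [] := grP a (subsetP sKA a Ka).
(* Such a [D] is the graph of an automorphism [b] of [S], the product of some [k0] in [K] and
   conjugation by [s0]. Only the orbit of [k0] contributes, with as many fixed points as the kernel
   of S -> Aut(S) has elements; this number does not depend on [D]. *)
- suffices main D : fusion_graph F D -> (#|S| <= #|D|)%N ->
      vmark SS c D = #|'ker_('N_S(S)) (conj_aut S)|%:Z.
    move=> D D' gD gD' leD pDD'; rewrite !main // -(card_proj2 gD') -pDD'.
    by rewrite (card_proj2 gD).
  move=> gD leSD; have /fusion_graphP[h Fh hD] := gD.
  have pD : proj1 D = S.
    by apply/val_inj/eqP; rewrite eqEcard (fhom_dom Fh) (card_proj1 gD).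
  rewrite pD in Fh.
  have [b Ab bh] := fAut_of_fhom Fh.
  have Db x : x \in S -> (x, b x) \in D.
    move=> Sx; have /proj1P[y Dxy] : x \in proj1 D by rewrite pD.
    by rewrite bh // -(hD _ Dxy).
  have : b \in K * I by rewrite (normC (subset_trans sKA (normal_norm nIA))) defA.
  case/mulsgP=> k0 _ Kk0 /morphimP[s0 Ns0 Ss0 ->] eb.
  (* A coset of the graph of [a] has a unique representative [(1, s)]; it is fixed by [D] exactly
     when [b] is [a] followed by conjugation by [s]. *)
  have markE a : a \in K ->
      mark SS (gr a) D = #|[set s in 'N_S(S) | b == a * conj_aut S s]|.
    move=> Ka; have Aa := subsetP sKA a Ka; have [ga pa mem_a] := grP a Aa.
    have [AAa Fa] := fAutP Aa; have [AAb Fb] := fAutP Ab.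
    pose q (s : gT) : gT * gT := (1, s).
    have injq : {in [set s in 'N_S(S) | b == a * conj_aut S s] &,
                  injective (fun s => gr a :* q s)}.
      move=> s s' _ _ eC; have : q s \in gr a :* q s' by rewrite -eC rcoset_refl.
      rewrite mem_rcoset mem_a /= => /andP[_]; rewrite invg1 mulg1 (fhom1 Fa).
      by rewrite -eq_mulgV1 => /eqP.
    rewrite -(card_in_imset injq); apply: eq_card => C; apply/setIP/imsetP.
      case=> /rcosetsP[[u v] /setXP[/= Su Sv] ->].
      have -> : gr a :* (u, v) = gr a :* q ((a u)^-1 * v).
        apply: rcoset_eqP; rewrite mem_rcoset mem_a /= invg1 mulg1 Su /=.
        by rewrite invMg invgK mulKVg.
      set s := _ * v; have Ss : s \in S.
        by rewrite groupM ?groupV // (fhom_img Fa).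
      rewrite sub_afixRs_norms => /subsetP sD.
      exists s => //; rewrite inE nSS //=.
      have Ns : s \in 'N(S) by have /setIP[] := nSS s Ss.
      apply/eqP/(eq_Aut AAb) => [|x Sx].
        by rewrite groupM // (subsetP (Aut_conj_aut S 'N_S(S))) // mem_morphim // nSS.
      rewrite permM norm_conj_autE ?(fhom_img Fa) //.
      have := sD _ (Db x Sx); rewrite mem_conjg.
      have -> : (x, b x) ^ (q s)^-1 = (x ^ 1^-1, b x ^ s^-1) by [].
      rewrite mem_a /= invg1 conjg1 => /andP[_ /eqP <-].
      by rewrite conjgKV.
    case=> s; rewrite inE => /andP[Ns /eqP ebs] ->; have Ss := SNS s Ns.
    split; first by apply/rcosetsP; exists (q s); rewrite // inE group1.
    rewrite sub_afixRs_norms; apply/subsetP=> -[x y] Dxy.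
    have Sx : x \in S by rewrite -pD (mem_proj1 Dxy).
    have /= -> := hD _ Dxy; rewrite -bh // mem_conjg.
    have -> : (x, b x) ^ (q s)^-1 = (x ^ 1^-1, b x ^ s^-1) by [].
    rewrite mem_a /= invg1 conjg1 Sx ebs permM norm_conj_autE ?(fhom_img Fa) //.
      by rewrite conjgK eqxx.
    by case/setIP: Ns.
  rewrite /vmark sum_c (bigD1 k0) //= big1 ?addr0 => [|a /andP[Ka nak0]]; last first.
    rewrite markE //; apply/eqP; rewrite -[0%R]/(Posz 0) eqz_nat cards_eq0.
    apply/eqP/setP=> s; rewrite in_set in_set0; apply/negbTE/negP.
    case/andP=> /setIP[Ss Ns] /eqP ebs; case/eqP: nak0.
    have : a^-1 * k0 \in I :&: K.
      rewrite inE [in X in _ && X]groupM ?groupV // andbT.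
      have -> : a^-1 * k0 = conj_aut S s * (conj_aut S s0)^-1.
        by apply: (canRL (mulgK _)); rewrite -mulgA -eb ebs mulKg.
      by rewrite groupM ?groupV // mem_morphim // inE Ss.
    by rewrite tiIK => /set1P/eqP; rewrite -eq_mulVg1 => /eqP.
  rewrite markE //; congr (Posz _); rewrite -[RHS](card_imset _ (mulIg s0)).
  apply: eq_card => s.
  apply/setIdP/imsetP=> [[NSs /eqP ebs] | [r /setIP[NSr /kerP kr] ->]].
    have Ns : s \in 'N(S) by case/setIP: NSs.
    exists (s * s0^-1); last by rewrite mulgKV.
    apply/setIP; split; first by rewrite groupM ?groupV.
    apply/kerP; first by rewrite groupM ?groupV.
    move: ebs; rewrite eb => /mulgI e0.
    by rewrite morphM ?groupV // morphV //= e0 mulgV.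
  have Nr : r \in 'N(S) by case/setIP: NSr.
  split; first by rewrite groupM.
  by rewrite morphM //= kr // mul1g eb.
- move=> E; rewrite /c -[0%R]/(Posz 0) eqz_nat -lt0n => /card_gt0P[a].
  rewrite inE => /andP[Ka /eqP<-].
  by have [/card_proj1 <- ->] := grP a (subsetP sKA a Ka).
(* The order of [K] is the index of a Sylow p-subgroup. *)
exists #|K|.
  have /and3P[_ _ p'i] := sylS; rewrite prime_coprime // -p'natE //.
  have -> // : #|K| = #|A : I|.
  rewrite -divgS // -defA TI_cardMg; last by rewrite tiIK.
  by rewrite mulKn ?cardG_gt0.
rewrite (eq_bigr (fun E => c E * 1)%R) => [|E _]; last by rewrite mulr1.
by rewrite sum_c sumr_const natz.
Qed.

End BisetExistence.

(** * Degree of the biset and stability on pairs of elements *)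

Section StableBiset.
Variables (p : nat) (gT : finGroupType) (S : {group gT}) (F : fusion_system S).
Hypotheses (p_pr : prime p) (pS : p.-group S) (satF : saturated p F).
Local Notation SS := (setX_group S S).
Local Open Scope ring_scope.
Local Open Scope group_scope.
Import GRing.Theory.

(** The summand |S : proj1 E| is the size of the orbit divided by |S|. It is divisible by p for
    proper [proj1 E], so modulo p only the graphs of order [#|S|] count. *)
Lemma ex_stable_biset : exists c : {group gT * gT} -> int,
  [/\ fusion_graph_supported F c, stable_above F 0 c &
      (\sum_E c E * #|S : proj1 E|%:Z)%:~R != 0%R :> 'F_p].
Proof.
have [c0 [supc0 stc0 c0S [m pm sum_c0]]] := ex_top_biset p_pr satF.
have [c [supc stc ec]] := stable_to_bottom pS satF supc0 stc0.
exists c; split=> //; rewrite rmorph_sum /=.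
suffices -> : (\sum_E (c E * #|S : proj1 E|%:Z)%:~R = m%:R :> 'F_p)%R.
  by rewrite -(dvdn_pcharf (pchar_Fp p_pr)) -prime_coprime.
rewrite -[RHS]/((m%:Z)%:~R)%R -sum_c0 rmorph_sum; apply: eq_bigr => E _.
have [leSE | ltES] := leqP #|S| #|E|.
  rewrite (ec E leSE); have [-> | /supc0 gE] := eqVneq (c0 E) 0; first by rewrite mul0r.
  suffices -> : proj1 E = S by rewrite indexgg mulr1.
  have [h Fh _] := fusion_graphP _ _ gE.
  by apply/val_inj/eqP; rewrite eqEcard (fhom_dom Fh) (card_proj1 gE).
have -> : c0 E = 0 by apply/eqP/idPn=> /c0S eES; rewrite eES ltnn in ltES.
have [-> | /supc gE] := eqVneq (c E) 0; first by rewrite mul0r.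
have [h Fh _] := fusion_graphP _ _ gE; have sPS := fhom_dom Fh.
rewrite intrM /= -[(Posz _)%:~R]/((#|S : proj1 E|)%:R).
suffices /eqP -> : ((#|S : proj1 E|)%:R == 0%R :> 'F_p) by rewrite mulr0.
rewrite -(dvdn_pcharf (pchar_Fp p_pr)).
have [[|n] en] := p_natP (pnat_dvd (dvdn_indexg S (proj1 E)) pS);
  last by rewrite en expnS dvdn_mulr.
move/eqP: en; rewrite expn0 indexg_eq1 => sSP.
by have := subset_leq_card sSP; rewrite (card_proj1 gE) leqNgt ltES.
Qed.

Lemma vmark_pair_stable c f u y :
    fusion_graph_supported F c -> stable_above F 0 c -> fhom F <[u]> S f ->
  vmark SS c [set (u, y)] = vmark SS c [set (f u, y)].
Proof.
move=> supc stc Ff; rewrite -vmark_gen -[RHS]vmark_gen.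
pose D := <[(u, y) : gT * gT]>%G; pose D' := <[(f u, y) : gT * gT]>%G.
have pD : proj1 D = <[u]>%G.
  by apply/val_inj; rewrite /= morphim_cycle ?inE.
pose ga (z : gT * gT) := (f z.1, z.2).
have gaM : {in D &, {morph ga : z t / z * t}}.
  by move=> z t Dz Dt; rewrite /ga /= (fhomM Ff) // -pD mem_proj1.
pose gm := Morphism gaM.
have eD' : D' :=: [set (f z.1, z.2) | z in D].
  rewrite -[RHS]/(ga @: D) -(morphimEsub gm (subxx D)) morphim_cycle //.
  exact: cycle_id.
have [|eg ep] := fusion_graph_transport Ff _ eD'; first by rewrite pD.
have [gD | ngD] := boolP (fusion_graph F D); first by apply: (stc D D'); rewrite -?eg.
by rewrite !(@vmark_nongraph _ _ F) // -eg.
Qed.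

End StableBiset.

(** * Transfer *)

Section TransferHom.
Variables (p : nat) (gT : finGroupType) (S P : {group gT}).
Hypothesis sPS : P \subset S.
Local Open Scope ring_scope.
Local Open Scope group_scope.
Import GRing.Theory FiniteModule.

Definition additive_on (A : {set gT}) (chi : gT -> 'F_p) : Prop :=
  {in A &, forall x y, chi (x * y) = (chi x + chi y)%R}.

(** [theta] is the transfer of [delta], whose image is abelian; the formula is its expansion along
    the cycles of [g] on the right cosets of [P]. *)
Lemma transfer_hom (delta : gT -> 'F_p) : additive_on P delta ->
  exists2 theta, additive_on S theta & forall g, g \in S ->
  exists2 X : {set gT}, is_transversal X (rcosets P S :* <[g]>) S &
    theta g = \sum_(x in X) delta ((g ^+ #|<[g]> : P :* x|) ^ x^-1)%g.
Proof.
move=> dM; have dM' : {in P &, {morph delta : x y / x * y}} by exact: dM.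
pose dm := Morphism dM'.
have abd : abelian (dm @* P).
  by apply/centsP=> x _ y _; rewrite /commute !FinRing.zmodMgE addrC.
pose tr := transfer S abd.
exists (fun g => fmval (tr g) : 'F_p) => [x y Sx Sy | g Sg].
  by rewrite /tr transferM // fmvalA.
have partX := rcosets_cycle_partition sPS Sg.
exists (transversal (rcosets P S :* <[g]>) S); first exact: transversalP.
rewrite /tr (transfer_cycle_expansion sPS abd Sg (transversalP partX)).
rewrite fmval_sum; apply: eq_bigr => x Xx.
have Py : ((g ^+ #|<[g]> : P :* x|) ^ x^-1)%g \in P.
  by rewrite conjgE invgK mulgA -mem_rcoset mulg_exp_card_rcosets.
by rewrite /restrm /= fmodK //; apply: (mem_morphim dm).
Qed.
End TransferHom.

(** * Cycles of an element on right cosets *)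

Section CycleCount.
Variables (gT : finGroupType) (S P : {group gT}) (g : gT).
Hypotheses (sPS : P \subset S) (Sg : g \in S).

(** Both are the length of the cycle of [g] through P x, by orbit-stabilizer. *)
Lemma index_cycle_rcoset x : #|<[g]> : P :* x| = #|<[g]> : P :^ x|.
Proof.
rewrite -[LHS](congr1 (fun A : {set {set gT}} => #|A|) (orbitRs <[g]>%G (P :* x))).
rewrite card_orbit -[RHS]indexgI; congr #|_ : _|.
by have := astab1_act 'Rs (gval P) x; rewrite /= rcosetE astab1Rs => <-.
Qed.

Lemma mem_expg_conj k x : (g ^+ k \in P :^ x) = (#|<[g]> : P :^ x| %| k).
Proof.
apply/idP/idP=> [Pgk | /dvdnP[m ->]].
  apply: (@dvdn_trans #|<[g]> : <[g ^+ k]>|).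
    rewrite -indexgI; apply: indexgS; rewrite subsetI cycleX /=.
    by rewrite cycle_subG.
  rewrite -divgS ?cycleX // -!orderE orderXgcd divnA ?dvdn_gcdl //.
  by rewrite mulKn ?order_gt0 // dvdn_gcdr.
rewrite mulnC expgM groupX // -index_cycle_rcoset mem_conjg conjgE invgK mulgA.
by rewrite -mem_rcoset mulg_exp_card_rcosets.
Qed.

Lemma card_rcoset_cycle x : #|P :* x * <[g]>| = (#|P| * #|<[g]> : P :^ x|)%N.
Proof.
have -> : P :* x * <[g]> = x *: (P :^ x * <[g]>).
  by rewrite conjsgE !mulgA mulg_set1 mulgV mul1g.
by rewrite card_lcoset -LagrangeMl cardJg.
Qed.

(** The condition is constant on the double coset of [x] by [P] and [<[g]>], since [g] commutes with
    its powers and [Phi] is P-invariant. The summand is the size of that double coset. *)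
Lemma count_transversal (X : {set gT}) (Phi : gT -> bool) k :
    is_transversal X (rcosets P S :* <[g]>) S ->
    {in P, forall z w, Phi (w ^ z) = Phi w} ->
  #|[set a in S | Phi ((g ^+ k) ^ a^-1)]| =
  \sum_(x in X | Phi ((g ^+ k) ^ x^-1)) (#|P| * #|<[g]> : P :^ x|).
Proof.
move=> trX PhiJ; have partX := rcosets_cycle_partition sPS Sg.
have sXS := subsetP (transversal_sub trX).
rewrite -sum1dep_card big_mkcondr /= (set_partition_big _ partX) /=.
rewrite -(pblock_transversal trX) big_imset /=; last exact: pblock_inj trX.
rewrite [RHS]big_mkcondr; apply: eq_bigr => x Xx.
have Sx := sXS x Xx.
have -> : pblock (rcosets P S :* <[g]>) x = P :* x * <[g]>.
  apply: def_pblock; first by case/and3P: partX.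
    by rewrite mem_mulg ?set11 // -rcosetE imset_f.
  by rewrite -[x]mulg1 mem_mulg ?rcoset_refl // mulg1 rcoset_refl.
rewrite (eq_bigr (fun=> if Phi ((g ^+ k) ^ x^-1)%g then 1 else 0)%N) => [|a].
  by rewrite sum_nat_const card_rcoset_cycle; case: ifP; rewrite ?muln1 ?muln0.
case/mulsgP=> _ _ /rcosetP[z Pz ->] /cycleP[i ->] ->.
have -> : (g ^+ k) ^ (z * x * g ^+ i)^-1 = ((g ^+ k) ^ x^-1) ^ z^-1.
  rewrite !invMg !conjgM; congr ((_ ^ _) ^ _).
  by apply/conjg_fixP/commgP; apply: commuteV; apply: commuteX2.
by rewrite PhiJ ?groupV.
Qed.

End CycleCount.

(** A coset E g is fixed by [X] exactly when [X] lies in E^g, a condition constant on its [#|E|]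
    elements. *)
Lemma card_mul_mark (gT : finGroupType) (G E : {group gT}) (X : {set gT}) :
  E \subset G ->
  (#|E| * mark G E X)%N = #|[set g in G | X \subset E :^ g]|.
Proof.
move=> sEG; rewrite -sum1dep_card big_mkcondr /=.
rewrite (set_partition_big _ (rcosets_partition sEG)) /=.
rewrite mulnC /mark -sum_nat_const [LHS](eq_bigl _ _ (fun C => in_setI C _ _)).
rewrite big_mkcondr /=; apply: eq_bigr => _ /rcosetsP[x Gx ->].
rewrite sub_afixRs_norms (eq_bigr (fun=> if X \subset E :^ x then 1 else 0)%N) => [|g].
  by rewrite sum_nat_const card_rcoset; case: ifP; rewrite ?muln1 ?muln0.
by case/rcosetP=> e Ee ->; rewrite conjsgM conjGid.
Qed.

Lemma Fp_mulrn_prime p (x : 'F_p) : prime p -> (x *+ p = 0)%R.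
Proof. by move=> p_pr; rewrite -GRing.mulr_natr pchar_Fp_0 // GRing.mulr0. Qed.

(** * Transfer along one graph in terms of marks *)

Section GraphTransfer.
Variables (p : nat) (gT : finGroupType) (S : {group gT}) (F : fusion_system S).
Hypotheses (p_pr : prime p) (pS : p.-group S).
Local Notation SS := (setX_group S S).
Local Open Scope ring_scope.
Local Open Scope group_scope.
Import GRing.Theory.

Variables (T : {group gT}) (chi : gT -> 'F_p).
Hypotheses (sTS : T \subset S) (nTS : S \subset 'N(T)).
Hypothesis closedT :
  forall (P : {group gT}) f t, fhom F P S f -> t \in P -> t \in T -> f t \in T.
Hypothesis chiM : additive_on T chi.
Hypothesis chiJ : {in T & S, forall t s, chi (t ^ s) = chi t}.

Lemma additive_on1 (A : {group gT}) (f : gT -> 'F_p) : additive_on A f -> f 1 = 0.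
Proof.
move=> fM; apply: (addrI (f 1)); rewrite addr0 -fM ?group1 ?mulg1 //.
Qed.

Lemma additive_onX (A : {group gT}) (f : gT -> 'F_p) x n :
  additive_on A f -> x \in A -> f (x ^+ n) = f x *+ n.
Proof.
move=> fM Ax; elim: n => [|n IHn]; first by rewrite expg0 (additive_on1 fM).
by rewrite expgS fM ?groupX // IHn mulrS.
Qed.

(** A sum of marks, hence F-invariant in [u] once summed over a stable biset; it also counts cycles
    in the transfer formula. *)
Definition fixed_count (E : {group gT * gT}) u (v : 'F_p) : nat :=
  (\sum_(y in T | chi y == v) mark SS E [set (u, y)])%N.

(** The pair [(u, y)] lies in E^(a, b) for the single [y = h (u ^ a^-1) ^ b], if for any. As [chi]
    is S-invariant, its value there is free of [b], which accounts for the factor [#|S|]. *)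
Lemma card_mul_fixed_count (E : {group gT * gT}) h u v
    (A := [set a in S | (u ^ a^-1 \in proj1 E) && (chi (h (u ^ a^-1)) == v)]) :
    fusion_graph F E -> fhom F (proj1 E) S h ->
    {in E, forall z, z.2 = h z.1} -> u \in T ->
  (#|E| * fixed_count E u v)%N = (#|S| * #|A|)%N.
Proof.
move=> gE Fh hE Tu; have sESS := fusion_graph_sub gE.
pose Pa a := (u ^ a^-1 \in proj1 E) && (chi (h (u ^ a^-1)) == v).
transitivity (\sum_(g in SS) (Pa g.1 : nat))%N; last first.
  transitivity (\sum_(a in S) \sum_(b in S) (Pa a : nat))%N.
    by rewrite pair_big /=; apply: eq_bigl => -[a b]; rewrite in_setX.
  rewrite /A -sum1dep_card big_mkcondr big_distrr /=; apply: eq_bigr => a _.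
  by rewrite sum_nat_const /Pa; case: ifP.
rewrite /fixed_count big_distrr /=.
rewrite (eq_bigr (fun y => \sum_(g in SS) (if [set (u, y)] \subset E :^ g then 1 else 0)%N)%N);
  last by move=> y _; rewrite card_mul_mark // -sum1dep_card big_mkcondr.
rewrite exchange_big /=; apply: eq_bigr => -[a b] /setXP[/= Sa Sb].
have memE y : ([set (u, y)] \subset E :^ (a, b)) =
    (u ^ a^-1 \in proj1 E) && (y == h (u ^ a^-1) ^ b).
  rewrite sub1set mem_conjg.
  have -> : (u, y) ^ (a, b)^-1 = (u ^ a^-1, y ^ b^-1) by [].
  rewrite -(can2_eq (conjgKV b) (conjgK b)) /=.
  apply/idP/andP=> [Ez | [/proj1P[y1 Ey1] /eqP->]].
    by split; [exact: mem_proj1 Ez | rewrite -(hE _ Ez)].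
  by rewrite -(hE _ Ey1).
have Tua : u ^ a^-1 \in T by rewrite memJ_norm // (subsetP nTS) ?groupV.
under eq_bigr => y _ do rewrite memE.
rewrite /Pa; have [Pu | _] /= := boolP (u ^ a^-1 \in proj1 E); last by rewrite big1.
have Thu := closedT Fh Pu Tua.
have ThuJ : h (u ^ a^-1) ^ b \in T by rewrite memJ_norm ?(subsetP nTS).
have [ev | nev] /= := eqVneq (chi (h (u ^ a^-1))) v.
  rewrite (bigD1 (h (u ^ a^-1) ^ b)) /= ?ThuJ ?chiJ ?ev ?eqxx //.
  by rewrite big1 ?addn0 // => y /andP[_ /negPf->].
rewrite big1 // => y /andP[_ /eqP ey]; case: eqP => // eyh; case/eqP: nev.
by rewrite -ey eyh chiJ.
Qed.

(** A cycle of length n through P x contributes [delta] of its return element x t^n x^-1, which is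
    [chi \o h] of it minus n chi(t). Grouping cycles by length and value gives the [k j v], and the
    marks recover these numbers. *)
Lemma graph_transfer (E : {group gT * gT}) h delta :
    fusion_graph F E -> fhom F (proj1 E) S h ->
    {in E, forall z, z.2 = h z.1} ->
    additive_on (proj1 E) delta ->
    {in proj1 E, forall x, x \in T -> delta x = (chi (h x) - chi x)%R} ->
  exists2 theta, additive_on S theta & forall t, t \in T ->
  exists2 k : nat -> 'F_p -> nat,
    forall j v, v != 0%R -> fixed_count E (t ^+ (p ^ j)) v = (#|S| * (p ^ j * k j v))%N &
    theta t = (\sum_(j < #|S|) \sum_(v | v != 0%R) v *+ k j v
               - chi t *+ #|S : proj1 E|)%R.
Proof.
move=> gE Fh hE dM dE; set P := proj1 E in Fh dM dE *.
have sPS := fhom_dom Fh.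
have [theta thM thE] := transfer_hom sPS dM.
exists theta => // t Tt; have St := subsetP sTS t Tt.
have [X trX ->] := thE t St; have sXS := subsetP (transversal_sub trX).
pose n x := #|<[t]> : P :^ x|.
have tVT x i : x \in S -> (t ^+ i) ^ x^-1 \in T.
  by move=> Sx; rewrite memJ_norm ?groupX // (subsetP nTS) ?groupV.
have tVP x i : ((t ^+ i) ^ x^-1 \in P) = (n x %| i)%N by rewrite -mem_conjg mem_expg_conj.
pose val x := chi (h ((t ^+ n x) ^ x^-1)).
exists (fun j v => #|[set x in X | (n x == p ^ j)%N && (val x == v)]|).
  move=> j v nzv; have Ttj : t ^+ (p ^ j) \in T by rewrite groupX.
  have P_gt0 : (0 < #|P|)%N := cardG_gt0 P.
  apply/eqP; rewrite -(eqn_pmul2l P_gt0) {1}(card_proj1 gE).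
  rewrite (card_mul_fixed_count v gE Fh hE Ttj) mulnCA eqn_pmul2l ?cardG_gt0 //.
  rewrite -/P.
  (* [chi] is known to be invariant only on [T]; the guard makes [Phi] invariant at every [w]. *)
  pose Phi w := (w \in P) && ((w \in T) ==> (chi (h w) == v)).
  have PhiJ : {in P, forall z w, Phi (w ^ z) = Phi w}.
    move=> z Pz w; have Sz := subsetP sPS z Pz.
    rewrite /Phi groupJr // memJ_norm ?(subsetP nTS) //.
    have [Pw | //] := boolP (w \in P); have [Tw | //] := boolP (w \in T).
    by rewrite (fhomJ Fh) // chiJ ?(closedT Fh) ?(fhom_img Fh).
  have := count_transversal sPS St (p ^ j) trX PhiJ.
  rewrite (_ : [set a in S | _] = [set a in S | ((t ^+ (p ^ j)) ^ a^-1 \in P) &&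
      (chi (h ((t ^+ (p ^ j)) ^ a^-1)) == v)]); last first.
    by apply/setP=> a; rewrite !in_set; case Sa: (a \in S); rewrite //= /Phi tVT.
  move->; apply/eqP; rewrite mulnA [RHS]mulnC -sum_nat_const.
  rewrite [RHS](eq_bigl (fun x => (x \in X) && ((n x == p ^ j)%N && (val x == v))));
    last by move=> x; rewrite in_set.
  (* A coset on a cycle of length p^i with i < j is also fixed by t^(p^j), but its value there is a
     multiple of p, so it is zero and differs from [v]. *)
  have PhiE x : x \in X ->
      Phi ((t ^+ (p ^ j)) ^ x^-1) = ((n x == p ^ j)%N && (val x == v)).
    move=> Xx; have Sx := sXS x Xx; rewrite /Phi tVP tVT //=.
    have [nx | nxj] := eqVneq (n x) (p ^ j)%N; first by rewrite /val nx dvdnn.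
    apply/negbTE/negP=> /andP[/(dvdn_pfactor _ _ p_pr)[i le_ij nx]].
    have lt_ij : (i < j)%N.
      by rewrite ltn_neqAle le_ij andbT; apply: contraNneq nxj => <-; rewrite nx.
    have Py : (t ^+ n x) ^ x^-1 \in P by rewrite tVP.
    have Ty : (t ^+ n x) ^ x^-1 \in T by rewrite tVT.
    rewrite -(subnK (ltnW lt_ij)) addnC expnD -nx expgM conjXg (fhomX _ Fh) //.
    rewrite (additive_onX _ chiM) ?(closedT Fh) //.
    rewrite -(subnSK lt_ij) expnS mulrnA Fp_mulrn_prime // mul0rn.
    by rewrite eq_sym (negPf nzv).
  rewrite [LHS](eq_bigl (fun x => (x \in X) && ((n x == p ^ j)%N && (val x == v)))).
    by apply: eq_bigr => x /and3P[_ /eqP nx _]; rewrite -/(n x) nx.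
  by move=> x; case Xx: (x \in X); rewrite //= PhiE.
(* Cycle lengths are powers p^e dividing [#|S|], whence e < [#|S|], the range of [j]. *)
have n_p x : exists e : 'I_(#|S|), n x == (p ^ e)%N.
  have : (n x %| #|S|)%N.
    by rewrite (dvdn_trans (dvdn_indexg _ _)) // cardSg // cycle_subG.
  have [m Sm] := p_natP pS.
  rewrite {1}Sm => /(dvdn_pfactor _ _ p_pr)[e lem ->].
  have lteS : (e < #|S|)%N.
    by rewrite Sm (leq_ltn_trans lem) // ltn_expl ?prime_gt1.
  by exists (Ordinal lteS).
have /fin_all_exists[e eP] := n_p.
have nE x j : (n x == p ^ j)%N = (e x == j :> nat).
  by rewrite (eqP (eP x)) eqn_exp2l ?prime_gt1.
transitivity (\sum_(x in X) (val x - chi t *+ n x))%R.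
  apply: eq_bigr => x Xx; have Sx := sXS x Xx; rewrite index_cycle_rcoset -/(n x).
  rewrite dE ?tVP ?tVT // -/(val x); congr (_ - _)%R.
  by rewrite chiJ ?groupX ?groupV // (additive_onX _ chiM).
rewrite sumrB; congr (_ - _)%R; last first.
  rewrite -(sum_index_rcosets_cycle sPS St trX) -sumrMnr.
  by apply: eq_bigr => x _; rewrite index_cycle_rcoset.
rewrite (partition_big e xpredT) //=; apply: eq_bigr => j _.
rewrite (partition_big val xpredT) //= [RHS]big_mkcond /=; apply: eq_bigr => v _.
rewrite (eq_bigr (fun=> v)) => [|x /andP[_ /eqP] //].
case: eqP => [-> | _] /=; first by rewrite big1.
rewrite sumr_const; congr (_ *+ _); apply: eq_card => x.
by rewrite !inE nE -val_eqE andbA.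
Qed.
End GraphTransfer.

(** * Correcting a cochain to be stable on [T] *)

Section StableExtension.
Variables (p : nat) (gT : finGroupType) (S : {group gT}) (F : fusion_system S).
Hypotheses (p_pr : prime p) (pS : p.-group S) (satF : saturated p F).
Local Notation SS := (setX_group S S).
Local Open Scope ring_scope.
Local Open Scope group_scope.
Import GRing.Theory.

Variables (T : {group gT}) (sigma : gT -> 'F_p).
Hypotheses (nTS : T <| S) (sNT : hyperfocal p F \subset T).
Hypothesis closedT :
  forall (P : {group gT}) f t, fhom F P S f -> t \in P -> t \in T -> f t \in T.

(** The coboundary of [sigma] as a 1-cochain. *)
Definition defect x y : 'F_p := (sigma x + sigma y - sigma (x * y))%R.

Hypothesis sigma1 : sigma 1 = 0%R.
Hypothesis defectT : forall x x' y y', x \in S -> x' \in S -> y \in S -> y' \in S ->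
  coset T x = coset T x' -> coset T y = coset T y' -> defect x y = defect x' y'.

Let sTS : T \subset S := normal_sub nTS.
Let nST : S \subset 'N(T) := normal_norm nTS.

(** The defect at (t, y) equals that at (1, y), which is zero. *)
Lemma sigma_mull t y : t \in T -> y \in S -> sigma (t * y) = (sigma t + sigma y)%R.
Proof.
move=> Tt Sy; have := @defectT t 1 y y (subsetP sTS t Tt) (group1 S) Sy Sy.
rewrite coset_id // morph1 /defect sigma1 mul1g add0r subrr => /(_ erefl erefl)/eqP.
by rewrite subr_eq0 => /eqP.
Qed.

Lemma sigma_mulr t y : t \in T -> y \in S -> sigma (y * t) = (sigma y + sigma t)%R.
Proof.
move=> Tt Sy; have := @defectT y y t 1 Sy Sy (subsetP sTS t Tt) (group1 S).
rewrite [coset T t]coset_id // morph1 /defect sigma1 mulg1 addr0 subrr => /(_ erefl erefl)/eqP.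
by rewrite subr_eq0 => /eqP.
Qed.

Lemma sigma_additive : additive_on T sigma.
Proof. by move=> x y Tx Ty; rewrite sigma_mull // (subsetP sTS). Qed.

Lemma sigmaJ : {in T & S, forall t s, sigma (t ^ s) = sigma t}.
Proof.
move=> t s Tt Ss; apply: (addrI (sigma s)).
have Tts : t ^ s \in T by rewrite memJ_norm // (subsetP nST).
by rewrite -sigma_mulr // -conjgC sigma_mull // addrC.
Qed.

(* The twist by [s] makes [h] the identity modulo [T], so that [sigma o h^s] and
   [sigma] have the same defect. *)
Lemma ex_graph_transfer (E : {group gT * gT}) :
  exists theta, additive_on S theta /\ (fusion_graph F E -> forall t, t \in T ->
  exists2 k : nat -> 'F_p -> nat,
    forall j v, v != 0%R ->
      fixed_count S T sigma E (t ^+ (p ^ j)) v = (#|S| * (p ^ j * k j v))%N &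
    theta t = (\sum_(j < #|S|) \sum_(v | v != 0%R) v *+ k j v
               - sigma t *+ #|S : proj1 E|)%R).
Proof.
have [gE | ngE] := boolP (fusion_graph F E); last first.
  (* A subgroup that is no graph gets the zero homomorphism, so that [theta] can be chosen for all
     [E] at once. *)
  by exists (fun=> 0%R); split=> // x y _ _; rewrite addr0.
have [h Fh hE] := fusion_graphP _ _ gE; have sPS := fhom_dom Fh.
have [s Ss hs] := fhom_conj_mod p_pr pS satF nTS sNT Fh.
pose h1 x := h x ^ s^-1.
have Sh1 x : x \in proj1 E -> h1 x \in S.
  by move=> Px; rewrite groupJ ?groupV ?(fhom_img Fh).
have h1T x : x \in proj1 E -> coset T (h1 x) = coset T x.
  move=> Px; rewrite /h1 (cosetJ nTS) ?groupV ?(fhom_img Fh) // hs //.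
  by rewrite -(cosetJ nTS (groupJ (subsetP sPS x Px) Ss) (groupVr Ss)) conjgK.
pose delta x := (sigma (h1 x) - sigma x)%R.
have dM : additive_on (proj1 E) delta.
  move=> x y Px Py; have Sx := subsetP sPS x Px; have Sy := subsetP sPS y Py.
  have := defectT (Sh1 x Px) Sx (Sh1 y Py) Sy (h1T x Px) (h1T y Py).
  rewrite /defect /delta /h1 (fhomM Fh) // conjMg.
  set a := sigma _; set b := sigma _; set c := sigma _; set d := sigma x.
  set e := sigma y; set f := sigma (x * y) => e1.
  by rewrite (_ : c = a + b - (d + e - f))%R; [ring | rewrite -e1; ring].
have dE : {in proj1 E, forall x, x \in T -> delta x = (sigma (h x) - sigma x)%R}.
  move=> x Px Tx; rewrite /delta /h1 sigmaJ ?groupV //.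
  exact: closedT Fh Px Tx.
have [theta thM thE] := graph_transfer p_pr pS sTS nST closedT sigma_additive sigmaJ
  gE Fh hE dM dE.
by exists theta.
Qed.

(** With [u] the degree of the stable biset and [theta0] the weighted sum of transfers,
    [theta0 + u sigma] is determined on [T] by marks, hence F-stable. As [u] is invertible in F_p,
    dividing by it gives the correction. *)
Lemma ex_stable_modification : exists2 theta, additive_on S theta &
  forall (P : {group gT}) f t, fhom F P S f -> t \in P -> t \in T ->
    (sigma (f t) + theta (f t) = sigma t + theta t)%R.
Proof.
have [c [supc stc nzc]] := ex_stable_biset p_pr pS satF.
have /fin_all_exists[theta_ thetaP] := ex_graph_transfer.
set u : 'F_p := (_%:~R)%R in nzc.
pose theta0 x : 'F_p := (\sum_E theta_ E x *~ c E)%R.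
have thM : additive_on S theta0.
  move=> x y Sx Sy; rewrite /theta0 -big_split; apply: eq_bigr => E _ /=.
  by have [thEM _] := thetaP E; rewrite thEM // mulrzDl.
have expand t : t \in T -> exists2 K : nat -> 'F_p -> int,
    forall j v, v != 0%R -> ((#|S| * p ^ j)%N%:Z * K j v)%R =
      (\sum_(y in T | sigma y == v) vmark SS c [set ((t ^+ (p ^ j))%g, y)])%R &
    (theta0 t + u * sigma t = \sum_(j < #|S|) \sum_(v | v != 0) v *~ K j v)%R.
  move=> Tt.
  have /fin_all_exists[k kP] : forall E, exists k : nat -> 'F_p -> nat, fusion_graph F E ->
      (forall j v, v != 0%R ->
        fixed_count S T sigma E (t ^+ (p ^ j)) v = (#|S| * (p ^ j * k j v))%N) /\
      theta_ E t = (\sum_(j < #|S|) \sum_(v | v != 0%R) v *+ k j v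
               - sigma t *+ #|S : proj1 E|)%R.
    move=> E; have [_ thE] := thetaP E.
    have [/thE/(_ t Tt)[k k1 k2] | ngE] := boolP (fusion_graph F E); first by exists k.
    by exists (fun _ _ => 0).
  exists (fun j v => \sum_E c E * (k E j v)%:Z)%R => [j v nzv |].
    rewrite [RHS]exchange_big /= mulr_sumr; apply: eq_bigr => E _.
    rewrite -mulr_sumr; have [-> | /supc/kP[kE _]] := eqVneq (c E) 0.
      by rewrite !mul0r mulr0.
    rewrite -(big_morph Posz PoszD (erefl _)) -/(fixed_count S T sigma E _ v) kE //.
    by rewrite mulrCA -PoszM mulnA.
  rewrite /u rmorph_sum mulr_suml -big_split /=.
  rewrite (eq_bigr (fun E => \sum_(j < #|S|) \sum_(v : 'F_p | v != 0) v *~ (c E * (k E j v)%:Z)))%R.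
    rewrite exchange_big; apply: eq_bigr => j _; rewrite exchange_big /=.
    by apply: eq_bigr => v _; rewrite mulrz_sumr.
  move=> E _; have [-> | /supc/kP[_ ->]] := eqVneq (c E) 0.
    have z0 (x : 'F_p) : (x *~ 0 = 0)%R by [].
    rewrite !mul0r !z0 addr0 big1 // => j _.
    by rewrite big1 // => v _; rewrite mul0r z0.
  rewrite mulrzBl -addrA mulrzl [(c E * _)%R]mulrC mulrzA addNr addr0.
  rewrite mulrz_suml; apply: eq_bigr => j _; rewrite mulrz_suml.
  by apply: eq_bigr => v _; rewrite mulrC mulrzA.
exists (fun x => u^-1 * theta0 x)%R => [x y Sx Sy | P f t Ff Pt Tt].
  by rewrite thM // mulrDr.
apply: (mulfI nzc); rewrite !mulrDr !mulrA divff // !mul1r ![(u * _ + _)%R]addrC.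
have Tft := closedT Ff Pt Tt.
have [K KE ->] := expand _ Tt; have [K' KE' ->] := expand _ Tft.
apply: eq_bigr => j _; apply: eq_bigr => v nzv; congr (_ *~ _)%R.
(* The multiplicities are compared as integers, where the factor |S| p^j can be cancelled before
   reducing modulo p. *)
have nz : ((#|S| * p ^ j)%N%:Z != 0)%R.
  by rewrite -lt0n muln_gt0 cardG_gt0 expn_gt0 prime_gt0.
apply: (mulfI nz); rewrite KE ?KE' //; apply: eq_bigr => y _.
rewrite -(fhomX _ Ff) //; apply/esym; apply: (vmark_pair_stable y supc stc).
by apply: (fhom_restr Ff); rewrite cycle_subG groupX.
Qed.

End StableExtension.

(** * Cohomology classes of degrees one and two *)

Section LowDegreeCochains.
Variables (p : nat) (G : finGroupType).
Local Open Scope ring_scope.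
Import GRing.Theory.
Local Notation cochain n := {ffun {ffun 'I_n -> G} -> 'F_p}.

Definition tuple1 (x : G) : {ffun 'I_1 -> G} := [ffun=> x].
Definition tuple2 (x y : G) : {ffun 'I_2 -> G} :=
  [ffun i => if i == ord0 then x else y].
Definition tuple3 (x y z : G) : {ffun 'I_3 -> G} :=
  [ffun i : 'I_3 => if val i == 0%N then x else if val i == 1%N then y else z].

Lemma tuple1E (t : {ffun 'I_1 -> G}) : t = tuple1 (t ord0).
Proof. by apply/ffunP=> i; rewrite ffunE ord1. Qed.

Lemma tuple2E (t : {ffun 'I_2 -> G}) : t = tuple2 (t ord0) (t ord_max).
Proof.
apply/ffunP=> i; rewrite ffunE; case: eqP => [-> // | /eqP ni].
by congr (t _); apply/val_inj; case: i ni => [[|[|]]].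
Qed.

Lemma tuple3E (t : {ffun 'I_3 -> G}) :
  t = tuple3 (t ord0) (t (lift ord0 ord0)) (t ord_max).
Proof.
apply/ffunP=> i; rewrite ffunE.
by case: i => [[|[|[|i]]]] lti //=; congr (t _); apply/val_inj.
Qed.

Lemma differential1E (b : cochain 1) x y :
  differential b (tuple2 x y) =
  b (tuple1 y) - b (tuple1 (x * y)%g) + b (tuple1 x).
Proof.
rewrite ffunE !big_ord_recl big_ord0 addr0 expr0 mul1r expr1 mulN1r.
rewrite /= sqrrN expr1n mul1r addrA.
congr (b _ - b _ + b _); rewrite [LHS]tuple1E; congr tuple1;
  by rewrite !ffunE /= ?ffunE /=.
Qed.

Lemma differential2E (b : cochain 2) x y z :
  differential b (tuple3 x y z) =
  b (tuple2 y z) - b (tuple2 (x * y)%g z) + b (tuple2 x (y * z)%g) - b (tuple2 x y).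
Proof.
rewrite ffunE !big_ord_recl big_ord0 addr0 expr0 mul1r expr1 mulN1r.
rewrite /= sqrrN expr1n mul1r exprS sqrrN expr1n mulr1 mulN1r !addrA.
congr (b _ - b _ + b _ - b _); rewrite [LHS]tuple2E; congr tuple2;
  by rewrite !ffunE /= ?ffunE /=.
Qed.

Lemma differential0E (b : cochain 0) : differential b = 0.
Proof.
apply/ffunP=> t; rewrite !ffunE !big_ord_recl big_ord0 addr0 expr0 mul1r expr1 mulN1r.
by apply/eqP; rewrite subr_eq0; apply/eqP; congr (b _); apply/ffunP=> -[].
Qed.

Lemma cocycle1P (c : cochain 1) :
  reflect (forall x y, c (tuple1 (x * y)%g) = c (tuple1 x) + c (tuple1 y))
          (c \in @is_cocycle p G 1).
Proof.
rewrite inE; apply: (iffP eqP) => [dc x y | cM].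
  have := differential1E c x y; rewrite dc ffunE => /esym/eqP.
  by rewrite addrAC subr_eq0 addrC => /eqP<-.
by apply/ffunP=> t; rewrite [t]tuple2E differential1E cM opprD !ffunE; ring.
Qed.

Lemma cocycle2P (c : cochain 2) :
  reflect (forall x y z, c (tuple2 y z) + c (tuple2 x (y * z)%g) =
                         c (tuple2 (x * y)%g z) + c (tuple2 x y))
          (c \in @is_cocycle p G 2).
Proof.
rewrite inE; apply: (iffP eqP) => [dc x y z | cM].
  have := differential2E c x y z; rewrite dc ffunE => /esym/eqP.
  rewrite subr_eq0 addrAC subr_eq => /eqP ->.
  exact: addrC.
apply/ffunP=> t; rewrite [t]tuple3E differential2E ffunE.
by rewrite [X in (X - _)%R]addrAC cM; ring.
Qed.

Local Open Scope quotient_scope.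

(** With trivial coefficients the differential out of degree zero vanishes. *)
Lemma eq_cohomology1 (c d : cocycle p G 1) :
  \pi_(group_cohomology p G 1) c = \pi_(group_cohomology p G 1) d ->
  val c = val d.
Proof.
move/eqP; rewrite pi_cohomologyE unfold_in => /existsP[b /eqP].
rewrite differential0E raddfB /= => /esym/eqP.
by rewrite subr_eq0 => /eqP.
Qed.

Lemma eq_cohomology2 (c d : cocycle p G 2) :
  reflect (exists b : G -> 'F_p, forall x y,
             val c (tuple2 x y) - val d (tuple2 x y) = b x + b y - b (x * y)%g)
          (\pi_(group_cohomology p G 2) c == \pi_(group_cohomology p G 2) d).
Proof.
rewrite pi_cohomologyE unfold_in; apply: (iffP existsP) => [[b /eqP bcd] | [b bcd]].
  exists (fun x => b (tuple1 x)) => x y.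
  have := differential1E b x y; rewrite bcd raddfB !ffunE => ->.
  by ring.
exists [ffun t : {ffun 'I_1 -> G} => b (t ord0)]; apply/eqP/ffunP=> t.
rewrite [t]tuple2E differential1E raddfB !ffunE bcd.
by ring.
Qed.

End LowDegreeCochains.

(** * Stable classes of degrees one and two as functions on the group *)

Section FusionCohomologyClasses.
Variables (p : nat) (gT : finGroupType) (S : {group gT}) (F : fusion_system S).
Local Open Scope ring_scope.
Local Open Scope quotient_scope.
Import GRing.Theory.

Definition fstable (chi : gT -> 'F_p) := forall (P : {group gT}) f x,
  fhom F P S f -> x \in P -> chi (f x) = chi x.

Lemma char_cocycleP (chi : gT -> 'F_p) : additive_on S chi ->
  [ffun t : {ffun 'I_1 -> subg_of S} => chi (val (t ord0))]
    \in @is_cocycle p (subg_of S) 1.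
Proof.
by move=> cM; apply/cocycle1P => x y; rewrite !ffunE /= cM ?subgP.
Qed.

Lemma subg_mapMs (P : {group gT}) f : fhom F P S f ->
  {morph @subg_map _ _ P S f : x y / (x * y)%g}.
Proof.
move=> Ff; apply: subg_mapM; last exact: fhomM Ff.
by move=> x Px; apply: (fhom_img Ff).
Qed.

Lemma subg_map_idM (P : {group gT}) : P \subset S ->
  {morph @subg_map _ _ P S id : x y / (x * y)%g}.
Proof. by move=> sPS; apply/subg_mapMs/fhom_sub. Qed.

Lemma ex_char_class (chi : gT -> 'F_p) (cM : additive_on S chi) : fstable chi ->
  exists z : fusion_cohomology p F 1,
    val z = \pi_(group_cohomology p (subg_of S) 1) (Cocycle (char_cocycleP cM)).
Proof.
move=> chiF; set c := Cocycle _.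
suffices cF : \pi_(group_cohomology p (subg_of S) 1) c \in @Defs.stable p _ _ F 1.
  by exists (FusionCohomology cF).
apply/Defs.stableP=> P f Ff; have sPS := fhom_dom Ff.
rewrite (cohomology_mapE (subg_map_idM sPS)) (cohomology_mapE (subg_mapMs Ff)).
congr (\pi_(group_cohomology p (subg_of P) 1) _).
apply: val_inj; rewrite (val_cocycle_map (subg_map_idM sPS)).
rewrite (val_cocycle_map (subg_mapMs Ff)); apply/ffunP=> t.
have Pt := subgP (t ord0); have St := subsetP sPS _ Pt.
by rewrite !ffunE /= !subgK ?(fhom_img Ff) // (chiF _ _ _ Ff).
Qed.

Lemma ex_char_of_class (z : fusion_cohomology p F 1) :
  exists chi, exists2 cM : additive_on S chi, fstable chi &
    val z = \pi_(group_cohomology p (subg_of S) 1) (Cocycle (char_cocycleP cM)).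
Proof.
pose c := generic_quotient.repr (val z).
have ec : val z = \pi_(group_cohomology p (subg_of S) 1) c by rewrite reprK.
pose chi x : 'F_p := val c (tuple1 (subg S x)).
have /cocycle1P cM' := valP c.
have cM : additive_on S chi.
  by move=> x y Sx Sy; rewrite /chi -cM' morphM.
exists chi; exists cM; last first.
  rewrite ec; congr (\pi_(group_cohomology p (subg_of S) 1) _); apply: val_inj.
  by apply/ffunP=> t; rewrite [t]tuple1E !ffunE /chi sgvalK.
move=> P f x Ff Px; have sPS := fhom_dom Ff.
have /Defs.stableP/(_ P f Ff) := valP z; rewrite ec.
rewrite (cohomology_mapE (subg_map_idM sPS)) (cohomology_mapE (subg_mapMs Ff)).
move/eq_cohomology1; rewrite (val_cocycle_map (subg_map_idM sPS)).
rewrite (val_cocycle_map (subg_mapMs Ff)).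
move/ffunP/(_ (tuple1 (subg P x))); rewrite !ffunE /chi => e.
transitivity (val c [ffun i => subg_map S f (tuple1 (subg P x) i)]).
  congr (val c _); apply/ffunP=> i; rewrite !ffunE; apply: val_inj.
  by rewrite /= !subgK ?(fhom_img Ff).
rewrite -e; congr (val c _); apply/ffunP=> i; rewrite !ffunE; apply: val_inj.
by rewrite /= !subgK ?(subsetP sPS).
Qed.

Definition cochain2 (c : gT -> gT -> 'F_p) : {ffun {ffun 'I_2 -> subg_of S} -> 'F_p} :=
  [ffun t : {ffun 'I_2 -> subg_of S} => c (val (t ord0)) (val (t ord_max))].

Lemma cochain2E c x y : cochain2 c (tuple2 x y) = c (val x) (val y).
Proof. by rewrite !ffunE. Qed.

Lemma cochain2_cocycleP (c : gT -> gT -> 'F_p) :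
    (forall x y z, x \in S -> y \in S -> z \in S ->
       c y z + c x (y * z)%g = c (x * y)%g z + c x y) ->
  cochain2 c \in @is_cocycle p (subg_of S) 2.
Proof.
by move=> cc; apply/cocycle2P => x y z; rewrite !cochain2E /= cc ?subgP.
Qed.

(** [b] witnesses that the restriction of [c] to [P] and its pullback along [f] are cohomologous. *)
Lemma ex_class2 (c : gT -> gT -> 'F_p)
    (cc : forall x y z, x \in S -> y \in S -> z \in S ->
       c y z + c x (y * z)%g = c (x * y)%g z + c x y) :
    (forall (P : {group gT}) f, fhom F P S f -> exists b : gT -> 'F_p,
       {in P &, forall x y, c x y - c (f x) (f y) = b x + b y - b (x * y)%g}) ->
  exists z : fusion_cohomology p F 2,
    val z = \pi_(group_cohomology p (subg_of S) 2) (Cocycle (cochain2_cocycleP cc)).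
Proof.
move=> cF; set d := Cocycle _.
suffices dF : \pi_(group_cohomology p (subg_of S) 2) d \in @Defs.stable p _ _ F 2.
  by exists (FusionCohomology dF).
apply/Defs.stableP=> P f Ff; have sPS := fhom_dom Ff.
rewrite (cohomology_mapE (subg_map_idM sPS)) (cohomology_mapE (subg_mapMs Ff)).
have [b bP] := cF P f Ff; apply/eqP/eq_cohomology2; exists (b \o val) => x y.
rewrite (val_cocycle_map (subg_map_idM sPS)) (val_cocycle_map (subg_mapMs Ff)).
rewrite !ffunE /= !subgK ?(fhom_img Ff) ?(subsetP sPS) ?subgP //.
by rewrite bP ?subgP.
Qed.

End FusionCohomologyClasses.

(** * The hypotheses on the induced map in terms of functions *)

Section InducedClasses.
Variables (p : nat) (gT1 gT2 : finGroupType) (S1 : {group gT1}) (S2 : {group gT2}).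
Variables (F1 : fusion_system S1) (F2 : fusion_system S2).
Variables (phi : {morphism S1 >-> gT2}) (phiF : fusion_preserving F1 F2 phi).
Local Open Scope ring_scope.
Local Open Scope quotient_scope.
Import GRing.Theory.

Let phiS := fusion_preserving_sub phiF.
Let phiM := subg_mapM phiS (@morphM _ _ _ phi).

Lemma induced_char_surj : bijective (induced_map p phiF 1) ->
  forall chi1 : gT1 -> 'F_p, additive_on S1 chi1 -> fstable F1 chi1 ->
  exists2 chi2 : gT2 -> 'F_p, additive_on S2 chi2 /\ fstable F2 chi2 &
    {in S1, chi2 \o phi =1 chi1}.
Proof.
case=> g _ gK chi1 cM1 cF1; have [z1 ez1] := ex_char_class cM1 cF1.
have [chi2 [cM2 cF2 ez2]] := ex_char_of_class (g z1).
exists chi2 => // x Sx.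
have := congr1 val (gK z1); rewrite ez1 [LHS]/= ez2 (cohomology_mapE phiM).
move/eq_cohomology1; rewrite (val_cocycle_map phiM) => /ffunP/(_ (tuple1 (subg S1 x))).
by rewrite !ffunE /= !subgK ?phiS.
Qed.

Lemma induced_char_inj : injective (induced_map p phiF 1) ->
  forall chi : gT2 -> 'F_p, additive_on S2 chi -> fstable F2 chi ->
  {in S1, forall x, chi (phi x) = 0} -> {in S2, forall y, chi y = 0}.
Proof.
move=> inj chi cM cF chi0 y Sy; have [z ez] := ex_char_class cM cF.
have zM : additive_on S2 (fun=> 0 : 'F_p) by move=> a b _ _; rewrite addr0.
have zF : fstable F2 (fun=> 0 : 'F_p) by [].
have [z0 ez0] := ex_char_class zM zF.
have e : z = z0.
  apply: inj; apply: val_inj; rewrite /= ez ez0 !(cohomology_mapE phiM).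
  congr (\pi_(group_cohomology p (subg_of S1) 1) _); apply: val_inj.
  rewrite !(val_cocycle_map phiM); apply/ffunP=> t; rewrite !ffunE /=.
  by rewrite subgK ?phiS ?subgP // chi0 ?subgP.
have := congr1 val e; rewrite ez ez0 => /eq_cohomology1/ffunP/(_ (tuple1 (subg S2 y))).
by rewrite !ffunE /= subgK.
Qed.

(** Injectivity is applied to the class of [c] and the zero class, whose images agree when [c]
    becomes a coboundary on [S1]. *)
Lemma induced_class2_inj : injective (induced_map p phiF 2) ->
  forall c : gT2 -> gT2 -> 'F_p,
    (forall x y z, x \in S2 -> y \in S2 -> z \in S2 ->
       c y z + c x (y * z)%g = c (x * y)%g z + c x y) ->
    (forall (P : {group gT2}) f, fhom F2 P S2 f -> exists b : gT2 -> 'F_p,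
       {in P &, forall x y, c x y - c (f x) (f y) = b x + b y - b (x * y)%g}) ->
    (exists b : gT1 -> 'F_p, {in S1 &, forall x y,
       c (phi x) (phi y) = b x + b y - b (x * y)%g}) ->
  exists b : gT2 -> 'F_p, {in S2 &, forall x y, c x y = b x + b y - b (x * y)%g}.
Proof.
move=> inj c cc cF [b bP]; have [z ez] := ex_class2 cc cF.
have z0 : forall x y z : gT2, x \in S2 -> y \in S2 -> z \in S2 -> 0 + 0 = 0 + 0 :> 'F_p by [].
have [|w ew] := @ex_class2 _ _ _ F2 (fun _ _ => 0) z0.
  by move=> P f Ff; exists (fun=> 0) => x y _ _; rewrite addr0.
have e : z = w.
  apply: inj; apply: val_inj; rewrite /= ez ew !(cohomology_mapE phiM).
  apply/eqP/eq_cohomology2; exists (b \o val) => x y.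
  rewrite !(val_cocycle_map phiM) !ffunE /= !subgK ?phiS ?subgP // subr0.
  by rewrite bP ?subgP.
have := congr1 val e; rewrite ez ew => /eqP/eq_cohomology2[d dP].
exists (fun x => d (subg S2 x)) => x y Sx Sy.
by have := dP (subg S2 x) (subg S2 y); rewrite !cochain2E /= !subgK // subr0 morphM.
Qed.

End InducedClasses.

(** * Comparison of the series *)

Section SeparatingCharacter.
Variables (p : nat) (gT : finGroupType) (T R : {group gT}).
Local Open Scope ring_scope.
Local Open Scope group_scope.
Import GRing.Theory.

(** T/R is elementary abelian, so some coordinate of the class of [x] in it is nonzero. *)
Lemma ex_separating_char x : prime p -> R \subset T -> T^`(1) \subset R ->
    {in T, forall t, t ^+ p \in R} -> x \in T -> x \notin R ->
  exists2 chi : gT -> 'F_p, additive_on T chi &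
    {in R, forall r, chi r = 0%R} /\ chi x != 0%R.
Proof.
move=> p_pr sRT sDR TpR Tx nRx.
have nRT : R <| T by rewrite sub_der1_normal.
have sTN := normal_norm nRT.
have abT : p.-abelem (T / R).
  rewrite abelemE // sub_der1_abelian //=; apply/exponentP=> _ /morphimP[t Nt Tt ->].
  by rewrite -morphX //= coset_id ?TpR.
have ntx : coset R x != 1 by apply: contra nRx => /eqP/coset_idr; apply; apply: (subsetP sTN).
have TRx : coset R x \in T / R by rewrite mem_quotient.
have ntT : T / R != 1 by apply/trivgPn; exists (coset R x).
pose rV := abelem_rV abT ntT.
have /rV0Pn[i nzi] : rV (coset R x) != 0%R.
  apply: contra ntx => /eqP rx0; apply/eqP.
  by apply: (@abelem_rV_inj p _ _ abT ntT _ _ TRx (group1 _)); rewrite abelem_rV_1.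
exists (fun y => rV (coset R y) 0 i) => [y z Ty Tz|].
  rewrite /rV morphM ?(subsetP sTN) //= abelem_rV_M ?mem_quotient //.
  by rewrite mxE.
by split=> [r Rr|]; [rewrite /rV coset_id // abelem_rV_1 mxE | exact: nzi].
Qed.
End SeparatingCharacter.

(** * Stable characters of the terms of the series *)

Section SeriesCharacters.
Variables (p : nat) (gT : finGroupType) (S : {group gT}) (F : fusion_system S).
Hypotheses (p_pr : prime p) (pS : p.-group S).
Local Notation T := (fseries p F).
Local Open Scope ring_scope.
Local Open Scope group_scope.
Import GRing.Theory.

Definition fstable_on (A : {set gT}) (chi : gT -> 'F_p) :=
  forall (P : {group gT}) f t, fhom F P S f -> t \in P -> t \in A -> chi (f t) = chi t.

Lemma additive_onV (A : {group gT}) (chi : gT -> 'F_p) x :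
  additive_on A chi -> x \in A -> chi x^-1 = (- chi x)%R.
Proof.
move=> cM Ax; apply/eqP; rewrite -addr_eq0 -cM ?groupV // mulVg.
by rewrite (additive_on1 cM).
Qed.

Lemma ex_char_kernel (A : {group gT}) (chi : gT -> 'F_p) : additive_on A chi ->
  exists K : {group gT}, forall x, (x \in K) = (x \in A) && (chi x == 0%R).
Proof.
move=> cM; have gK : group_set [set x in A | chi x == 0%R].
  apply/group_setP; split=> [|x y]; first by rewrite inE group1 (additive_on1 cM) /=.
  by rewrite !inE => /andP[Ax /eqP x0] /andP[Ay /eqP y0]; rewrite groupM //= cM // x0 y0 addr0.
by exists (Group gK) => x; rewrite inE.
Qed.

(** The kernel contains the generators t^p and t f(t^-1). With the converse [kernel_fstable_on],
    stable characters of [T n] are those of its quotient by [T n.+1]. *)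
Lemma fstable_on_kernel n chi : additive_on (T n) chi -> fstable_on (T n) chi ->
  {in T n.+1, forall x, chi x = 0%R}.
Proof.
move=> cM cF; have sTT := fseriesS p F n; have sTS := fseries_sub p F n.
have [K KE] := ex_char_kernel cM.
suffices sTK : T n.+1 \subset K.
  by move=> x /(subsetP sTK); rewrite KE => /andP[_ /eqP].
rewrite join_subG !gen_subG; apply/andP; split; apply/subsetP=> x.
  case/imsetP=> t Tt ->.
  by rewrite KE groupX //= (additive_onX _ cM) // Fp_mulrn_prime.
rewrite inE => /exists_inP[t Tt /existsP[f /andP[Ff /eqP->]]]; rewrite KE.
rewrite groupM ?(fhom_img Ff) ?groupV ?cycle_id //=.
have tV : t^-1 \in <[t]> by rewrite groupV cycle_id.
have FfS : fhom F <[t]> S f.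
  by apply: (fhom_corestr Ff) => // y ty; rewrite (subsetP sTS) ?(fhom_img Ff).
rewrite cM ?(fhom_img Ff) // (cF _ _ _ FfS tV) ?groupV //.
by rewrite (additive_onV cM) // addrN eqxx.
Qed.

Lemma kernel_fstable_on n chi : additive_on (T n) chi ->
  {in T n.+1, forall x, chi x = 0%R} -> fstable_on (T n) chi.
Proof.
move=> cM c0 P f t Ff Pt Tt; have Tc := fseries_fhom_comm Ff Pt Tt.
have Tc' := subsetP (fseriesS p F n) _ Tc.
by rewrite -[f t](mulKVg t) cM // (c0 _ Tc) addr0.
Qed.

Lemma fseries_der1 n : (T n)^`(1) \subset T n.+1.
Proof.
rewrite derg1 gen_subG; apply/subsetP=> _ /imset2P[x y Tx Ty ->].
have [Sx Sy] := (subsetP (fseries_sub p F n) x Tx, subsetP (fseries_sub p F n) y Ty).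
rewrite commgEl; apply: (@fseries_fhom_comm _ _ _ _ _ S (conjg^~ y)) => //.
by apply: fhom_conj; rewrite ?conjGid.
Qed.

Hypothesis satF : saturated p F.

Definition hyperfocal_group : {group gT} := <<hyperfocal p F>>%G.

Lemma hyperfocal_groupE : hyperfocal_group :=: hyperfocal p F.
Proof. by rewrite /= genGid. Qed.

(** Modulo the hyperfocal subgroup a morphism is conjugation in [S], which a homomorphism to an
    abelian group does not see. *)
Lemma kernel_hyperfocal_fstable (chi : gT -> 'F_p) : additive_on S chi ->
  {in hyperfocal p F, forall x, chi x = 0%R} -> fstable F chi.
Proof.
move=> cM c0 P f x Ff Px; have sPS := fhom_dom Ff.
have nHS : hyperfocal_group <| S.
  by rewrite /normal hyperfocal_groupE; exact: hyperfocal_normal.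
have sH : hyperfocal p F \subset hyperfocal_group by rewrite hyperfocal_groupE.
have [s Ss fs] := fhom_conj_mod p_pr pS satF nHS sH Ff.
have Sx := subsetP sPS x Px; have Sfx := fhom_img Ff Px.
have sSN := subsetP (normal_norm nHS).
have Hc : (x ^ s)^-1 * f x \in hyperfocal_group.
  by apply/eq_cosetP; rewrite ?sSN ?groupJ // fs.
rewrite -[f x](mulKVg (x ^ s)) cM ?groupM ?groupV ?groupJ //.
rewrite [X in (_ + X)%R]c0 ?addr0 -?hyperfocal_groupE //.
by rewrite conjgE !cM ?groupM ?groupV // (additive_onV cM) // addrCA addNr addr0.
Qed.

Lemma fseries_eventually : exists m, forall n, (m <= n)%N -> T n :=: hyperfocal p F.
Proof.
have [m eT] : exists m, T m.+1 = T m.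
  (* Each strict step lowers the order by at least one, so fewer than [#|S|] steps are strict. *)
  have dec n : (exists m, T m.+1 = T m) \/ (#|T n| + n <= #|S|)%N.
    elim: n => [|n [ex | IHn]]; [by right; rewrite addn0 | by left |].
    have [eT | neT] := eqVneq (T n.+1) (T n); first by left; exists n.
    right; rewrite addnS; apply: leq_trans IHn; rewrite -addSn leq_add2r.
    rewrite proper_card // properEneq fseriesS andbT.
    by rewrite (inj_eq val_inj).
  by have [// | ] := dec #|S|; rewrite leqNgt -{1}[#|S|]add0n ltn_add2r cardG_gt0.
have eN := fseries_stationary p_pr pS satF eT.
exists m => n le_mn; apply/eqP; rewrite eqEsubset hyperfocal_sub_fseries // andbT.
by rewrite -eN fseries_le.
Qed.

End SeriesCharacters.

(** * Extending an invariant character to a cochain *)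

Section ExtendCharacter.
Variables (p : nat) (gT : finGroupType) (G T : {group gT}) (chi : gT -> 'F_p).
Hypotheses (nTG : T <| G) (chiM : additive_on T chi).
Hypothesis chiJ : {in T & G, forall t s, chi (t ^ s) = chi t}.
Local Open Scope ring_scope.
Local Open Scope group_scope.
Import GRing.Theory.

Let sTG := subsetP (normal_sub nTG).
Let sGN := subsetP (normal_norm nTG).

Lemma ex_extension : exists2 sigma : gT -> 'F_p, {in T, sigma =1 chi} &
  {in G & T, forall x t, sigma (x * t) = (sigma x + chi t)%R}.
Proof.
(* The representative of the coset [T] itself is 1, which makes the cochain agree with [chi] on
   [T]. *)
pose r x := repr (x *: T).
have rT x : (r x)^-1 * x \in T.
  have : r x \in x *: T by apply: (mem_repr x); rewrite lcoset_refl.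
  by case/lcosetP=> t Tt ->; rewrite invMg -mulgA mulVg mulg1 groupV.
exists (fun x => chi ((r x)^-1 * x)) => [t Tt | x t Gx Tt].
  by rewrite /r lcoset_id // repr_group invg1 mul1g.
by rewrite /r lcosetM lcoset_id // mulgA chiM ?rT.
Qed.

Variable sigma : gT -> 'F_p.
Hypothesis sigmaT : {in T, sigma =1 chi}.
Hypothesis sigmaM : {in G & T, forall x t, sigma (x * t) = (sigma x + chi t)%R}.

Lemma coset_mul x x' : x \in G -> x' \in G -> coset T x = coset T x' ->
  exists2 t, t \in T & x' = x * t.
Proof.
move=> Gx Gx' e; exists (x^-1 * x'); last by rewrite mulKVg.
by apply/eq_cosetP; rewrite ?sGN.
Qed.

(** Since x t y u = x y t^y u and chi(t^y) = chi(t), the contributions of t and u cancel. *)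
Lemma defect_coset x x' y y' : x \in G -> x' \in G -> y \in G -> y' \in G ->
  coset T x = coset T x' -> coset T y = coset T y' ->
  defect sigma x y = defect sigma x' y'.
Proof.
move=> Gx Gx' Gy Gy' /(coset_mul Gx Gx')[t Tt ->] /(coset_mul Gy Gy')[u Tu ->].
have Tty : t ^ y \in T by rewrite memJ_norm ?sGN.
rewrite /defect (_ : x * t * (y * u) = (x * y) * (t ^ y * u)); last first.
  by rewrite conjgE !mulgA mulgK.
rewrite (sigmaM Gx Tt) (sigmaM Gy Tu) (sigmaM (groupM Gx Gy) (groupM Tty Tu)).
by rewrite chiM // chiJ //; ring.
Qed.

Lemma sigma_conj_coset s x x' : s \in G -> x \in G -> x' \in G ->
    coset T x = coset T x' ->
  (sigma x - sigma (x ^ s) = sigma x' - sigma (x' ^ s))%R.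
Proof.
move=> Gs Gx Gx' /(coset_mul Gx Gx')[t Tt ->].
have Tts : t ^ s \in T by rewrite memJ_norm ?sGN.
have Gxs := groupJ Gx Gs.
by rewrite conjMg (sigmaM Gx Tt) (sigmaM Gxs Tts) chiJ //; ring.
Qed.
End ExtendCharacter.

Lemma defect_cocycle p (gT : finGroupType) (sigma : gT -> 'F_p) x y z :
  (defect sigma y z + defect sigma x (y * z)%g =
   defect sigma (x * y)%g z + defect sigma x y)%R.
Proof. by rewrite /defect mulgA; ring. Qed.

(** * The induction comparing the two series along [phi] *)

Section Comparison.
Variables (p : nat) (gT1 gT2 : finGroupType) (S1 : {group gT1}) (S2 : {group gT2}).
Variables (F1 : fusion_system S1) (F2 : fusion_system S2).
Variable phi : {morphism S1 >-> gT2}.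
Hypotheses (p_pr : prime p) (pS1 : p.-group S1) (pS2 : p.-group S2).
Hypotheses (satF1 : saturated p F1) (satF2 : saturated p F2).
Hypothesis phiF : fusion_preserving F1 F2 phi.
Hypothesis phi1_iso : bijective (induced_map p phiF 1).
Hypothesis phi2_mono : injective (induced_map p phiF 2).
Local Notation T1 := (fseries p F1).
Local Notation T2 := (fseries p F2).
Local Open Scope ring_scope.
Local Open Scope group_scope.
Import GRing.Theory.

Let phiS := fusion_preserving_sub phiF.

Lemma phi_fseries n : {in T1 n, forall x, phi x \in T2 n}.
Proof.
elim: n => [x | n IHn]; first exact: phiS.
have sTS := subsetP (fseries_sub p F1 n).
suffices /subsetP sub : T1 n.+1 \subset phi @*^-1 T2 n.+1.
  by move=> x /sub/morphpreP[].
rewrite join_subG !gen_subG; apply/andP; split; apply/subsetP=> x.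
  case/imsetP=> t Tt ->; rewrite mem_morphpre ?groupX ?sTS //.
  by rewrite morphX ?sTS // fseries_expp ?IHn.
rewrite inE => /exists_inP[t Tt /existsP[f /andP[Ff /eqP->]]].
have tV : t^-1 \in <[t]> by rewrite groupV cycle_id.
have St := sTS t Tt; have StV : t^-1 \in S1 by rewrite groupV.
have FfS : fhom F1 <[t]> S1 f.
  by apply: (fhom_corestr Ff) => // y ty; rewrite sTS ?(fhom_img Ff).
have sPS := fhom_dom FfS; have [f' Ff' ff'] := phiF sPS FfS.
have Sft := fhom_img FfS tV.
rewrite mem_morphpre ?groupM // morphM // ff' //.
rewrite -[phi t]invgK -morphV //; apply: (fseries_fhom_comm Ff').
  by rewrite mem_morphim.
by rewrite IHn ?groupV.
Qed.

(** If the image of [phi] and [T2 n] failed to generate [S2] modulo the Frattini subgroup, some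
    nonzero character of [S2] would vanish on both. Vanishing on the hyperfocal subgroup, it is
    F2-stable and dies on [S1], against injectivity on H^1. *)
Lemma phi_surj n y : y \in S2 -> exists2 x, x \in S1 & (phi x)^-1 * y \in T2 n.
Proof.
move=> Sy; have sphi : phi @* S1 \subset S2.
  by apply/subsetP=> _ /morphimP[x _ Sx ->]; apply: phiS.
have sTS := fseries_sub p F2 n.
pose R := (phi @* S1 <*> T2 n)%G.
have sRS : R \subset S2 by rewrite join_subG sphi.
suffices sSR : S2 \subset R.
  have := subsetP sSR y Sy; rewrite /= norm_joinEl; last first.
    exact: subset_trans sphi (normal_norm (fseries_normal p F2 n)).
  case/mulsgP=> _ t /morphimP[x _ Sx ->] Tt ->.
  by exists x; rewrite ?mulKg.
suffices eR : R <*> 'Phi(S2) = S2.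
  by rewrite -{1}(Phi_nongen (etrans (joingC _ _) eR)) genGid.
apply/eqP; rewrite eqEsubset join_subG sRS Phi_sub /=; apply/subsetPn=> -[z Sz nRz].
have sPhiR : 'Phi(S2) \subset R <*> 'Phi(S2) by exact: joing_subr.
have [|||chi cM [c0 cz]] := @ex_separating_char p _ S2 (R <*> 'Phi(S2))%G z p_pr _ _ _ Sz nRz.
- by rewrite join_subG sRS Phi_sub.
- by apply: subset_trans sPhiR; rewrite (Phi_joing pS2) joing_subl.
- move=> t St; apply: (subsetP sPhiR); rewrite (Phi_joing pS2).
  apply: (subsetP (joing_subr _ _)).
  by rewrite -[p in _ ^+ p]expn1 Mho_p_elt // (mem_p_elt pS2).
have sTR : T2 n \subset R <*> 'Phi(S2).
  exact: subset_trans (joing_subr _ _) (joing_subl _ _).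
have cF : fstable F2 chi.
  apply: (kernel_hyperfocal_fstable p_pr pS2 satF2 cM) => x Nx.
  by rewrite c0 // (subsetP sTR) // (subsetP (hyperfocal_sub_fseries F2 p_pr n)).
have chi0 : {in S1, forall x, chi (phi x) = 0%R}.
  move=> x Sx; rewrite c0 //; apply: (subsetP (joing_subl _ _)).
  by apply: (subsetP (joing_subl _ _)); rewrite mem_morphim.
by rewrite (induced_char_inj (bij_inj phi1_iso) cM cF chi0) ?eqxx in cz.
Qed.

(** The inductive step: the hypothesis on [phi] makes S1/T1_n -> S2/T2_n injective, and the
    characters obtained detect elements of [T1 n] outside [T1 n.+1]. *)
Lemma char_lift n (chi1 : gT1 -> 'F_p) : (0 < n)%N ->
    {in S1, forall x, phi x \in T2 n -> x \in T1 n} ->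
    additive_on (T1 n) chi1 -> {in T1 n.+1, forall x, chi1 x = 0%R} ->
  exists2 chi2 : gT2 -> 'F_p,
    additive_on (T2 n) chi2 /\ fstable_on F2 (T2 n) chi2 &
    {in T1 n, chi2 \o phi =1 chi1}.
Proof.
move=> n_gt0 phiT cM c0.
have nT1 := fseries_normal p F1 n; have nT2 := fseries_normal p F2 n.
have sTS1 := subsetP (fseries_sub p F1 n); have sTS2 := subsetP (fseries_sub p F2 n).
have sSN1 := subsetP (normal_norm nT1); have sSN2 := subsetP (normal_norm nT2).
have cF := kernel_fstable_on cM c0.
have cJ : {in T1 n & S1, forall t s, chi1 (t ^ s) = chi1 t}.
  move=> t s Tt Ss; apply: (cF S1 (conjg^~ s)) => //; last exact: sTS1.
  by apply: fhom_conj; rewrite ?conjGid.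
have [sigma1 s1T s1M] := ex_extension S1 cM.
have D1 := defect_coset nT1 cM cJ s1M.
have B1 := sigma_conj_coset nT1 cJ s1M.
(* [l] inverts the isomorphism S1 / T1 n -> S2 / T2 n induced by [phi] *)
have /fin_all_exists[l lP] : forall y, exists x, y \in S2 ->
    x \in S1 /\ coset (T2 n) (phi x) = coset (T2 n) y.
  move=> y; have [Sy | nSy] := boolP (y \in S2); last by exists 1.
  have [x Sx xy] := phi_surj n Sy.
  by exists x; split=> //; apply/eq_cosetP; rewrite ?sSN2 ?phiS.
have Sl y : y \in S2 -> l y \in S1 by case/lP.
have lK y : y \in S2 -> coset (T2 n) (phi (l y)) = coset (T2 n) y by case/lP.
have phi_inj x x' : x \in S1 -> x' \in S1 ->
    coset (T2 n) (phi x) = coset (T2 n) (phi x') -> coset (T1 n) x = coset (T1 n) x'.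
  move=> Sx Sx' /eq_cosetP; rewrite !sSN2 ?phiS // => /(_ isT isT) xT.
  apply/eq_cosetP; rewrite ?sSN1 //; apply: phiT; first by rewrite groupM ?groupV.
  by rewrite morphM ?groupV // morphV.
have lM y z : y \in S2 -> z \in S2 -> coset (T1 n) (l (y * z)) = coset (T1 n) (l y * l z).
  move=> Sy Sz; apply: phi_inj; rewrite ?groupM ?Sl ?groupM // morphM ?Sl //.
  rewrite lK ?groupM // !morphM ?sSN2 ?phiS ?Sl //=.
  by rewrite !lK.
have l_coset y z : y \in S2 -> z \in S2 -> coset (T2 n) y = coset (T2 n) z ->
    coset (T1 n) (l y) = coset (T1 n) (l z).
  by move=> Sy Sz e; apply: phi_inj; rewrite ?Sl // !lK.
have l_phi x : x \in S1 -> coset (T1 n) (l (phi x)) = coset (T1 n) x.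
  by move=> Sx; apply: phi_inj; rewrite ?Sl ?lK ?phiS.
pose c y z := defect sigma1 (l y) (l z).
have c_phi x y : x \in S1 -> y \in S1 -> c (phi x) (phi y) = defect sigma1 x y.
  by move=> Sx Sy; apply: D1; rewrite ?Sl ?phiS ?l_phi.
have c_cocycle x y z : x \in S2 -> y \in S2 -> z \in S2 ->
    (c y z + c x (y * z)%g = c (x * y)%g z + c x y)%R.
  move=> Sx Sy Sz; rewrite /c.
  rewrite (D1 (l x) (l x) (l (y * z)) (l y * l z)) ?groupM ?Sl ?groupM ?lM //.
  rewrite (D1 (l (x * y)) (l x * l y) (l z) (l z)) ?groupM ?Sl ?groupM ?lM //.
  exact: defect_cocycle.
have c_coset x x' y y' : x \in S2 -> x' \in S2 -> y \in S2 -> y' \in S2 ->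
    coset (T2 n) x = coset (T2 n) x' -> coset (T2 n) y = coset (T2 n) y' ->
    c x y = c x' y'.
  by move=> Sx Sx' Sy Sy' ex ey; apply: D1; rewrite ?Sl //; apply: l_coset.
have c_stable (P : {group gT2}) f : fhom F2 P S2 f -> exists b : gT2 -> 'F_p,
    {in P &, forall x y, c x y - c (f x) (f y) = b x + b y - b (x * y)%g}%R.
  move=> Ff; have sPS := subsetP (fhom_dom Ff).
  have sNT := hyperfocal_sub_fseries F2 p_pr n.
  have [s Ss fs] := fhom_conj_mod p_pr pS2 satF2 nT2 sNT Ff.
  (* Modulo [T2 n], [f] is conjugation by [s], matched on [S1] by [l s]. By [B1] this difference
     depends only on classes modulo [T1 n], and [l] is multiplicative on those. *)
  exists (fun x => sigma1 (l x) - sigma1 (l x ^ l s)%g)%R => x y Px Py.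
  have [Sx Sy] := (sPS x Px, sPS y Py); have Sls := Sl s Ss.
  have lJ z : z \in S2 -> coset (T1 n) (l (z ^ s)) = coset (T1 n) (l z ^ l s).
    move=> Sz; apply: phi_inj; rewrite ?groupJ ?Sl ?groupJ // morphJ ?Sl //.
    rewrite lK ?groupJ // !morphJ ?sSN2 ?phiS ?Sl //=.
    by rewrite !lK.
  have -> : c (f x) (f y) = defect sigma1 (l x ^ l s) (l y ^ l s).
    rewrite (c_coset _ (x ^ s) _ (y ^ s)) ?(fhom_img Ff) ?groupJ ?fs //.
    by apply: D1; rewrite ?groupJ ?Sl ?groupJ ?lJ.
  have Sxy : x * y \in S2 by rewrite groupM.
  rewrite (B1 (l s) (l (x * y)) (l x * l y)) ?groupM ?Sl ?lM //.
  by rewrite /c /defect conjMg; ring.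
(* Pulled back along [phi], [c] is the coboundary of [sigma1]. *)
have [|sigma2 s2P] := induced_class2_inj phi2_mono c_cocycle c_stable.
  by exists sigma1 => x y Sx Sy; rewrite c_phi.
have s2D x y : x \in S2 -> y \in S2 -> defect sigma2 x y = c x y.
  by move=> Sx Sy; rewrite s2P.
have s21 : sigma2 1 = 0%R.
  have := s2P 1 1 (group1 _) (group1 _).
  rewrite -{1 2}(morph1 phi) c_phi ?group1 // /defect !mulg1 !addrK.
  by rewrite s1T // (additive_on1 cM).
have s2c x x' y y' : x \in S2 -> x' \in S2 -> y \in S2 -> y' \in S2 ->
    coset (T2 n) x = coset (T2 n) x' -> coset (T2 n) y = coset (T2 n) y' ->
    defect sigma2 x y = defect sigma2 x' y'.
  by move=> Sx Sx' Sy Sy' ex ey; rewrite !s2D //; apply: c_coset.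
have clT (P : {group gT2}) f t : fhom F2 P S2 f -> t \in P -> t \in T2 n -> f t \in T2 n.
  by move=> Ff; apply: fseries_fhom.
have [theta thM thF] := ex_stable_modification p_pr pS2 satF2 nT2
  (hyperfocal_sub_fseries F2 p_pr n) clT s21 s2c.
pose chi2 x := (sigma2 x + theta x)%R.
have c2M : additive_on (T2 n) chi2.
  move=> x y Tx Ty; rewrite /chi2 (sigma_additive nT2 s21 s2c) // thM ?sTS2 //.
  by ring.
have c2F : fstable_on F2 (T2 n) chi2 by move=> P f t; apply: thF.
exists chi2 => // x Tx; have Sx := sTS1 x Tx.
(* [chi2 o phi] and [sigma1] have the same defect *)
pose eta x := (chi2 (phi x) - sigma1 x)%R.
have etaM : additive_on S1 eta.
  move=> a b Sa Sb; rewrite /eta /chi2 morphM // thM ?phiS //.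
  have := s2D (phi a) (phi b); rewrite c_phi // !phiS // => /(_ isT isT).
  rewrite /defect => e.
  rewrite (_ : sigma2 (phi a * phi b)%g = sigma2 (phi a) + sigma2 (phi b) -
    (sigma1 a + sigma1 b - sigma1 (a * b)%g))%R; [ring | rewrite -e; ring].
have etaF : fstable_on F1 (T1 n) eta.
  move=> P f t Ff Pt Tt; have sPS := fhom_dom Ff; have [f' Ff' ff'] := phiF sPS Ff.
  have Tft := fseries_fhom Ff Pt Tt.
  rewrite /eta ff' // !s1T // (cF _ _ _ Ff) // (c2F _ _ _ Ff') ?phi_fseries //.
  by rewrite mem_morphim ?sTS1.
have etaMT : additive_on (T1 n) eta by move=> a b Ta Tb; apply: etaM; apply: sTS1.
(* Stable on [T1 n], [eta] kills [T1 n.+1] and so the hyperfocal subgroup. It is therefore stable on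
   all of [S1] and kills [T1 1], which contains [T1 n] because n > 0. *)
have eta0 := fstable_on_kernel p_pr etaMT etaF.
have etaFS : fstable F1 eta.
  apply: (kernel_hyperfocal_fstable p_pr pS1 satF1 etaM) => a Na.
  by rewrite eta0 // (subsetP (hyperfocal_sub_fseries F1 p_pr n.+1)).
have eta1 : {in T1 1, forall a, eta a = 0%R}.
  apply: (@fstable_on_kernel _ _ _ F1 p_pr 0) => // P f t Ff Pt _.
  exact: etaFS Ff Pt.
have := eta1 x (subsetP (fseries_le p F1 n_gt0) x Tx).
by rewrite /eta s1T // => /eqP; rewrite subr_eq0 => /eqP.
Qed.

(** An element violating this is detected by a character that extends along [phi] to an F2-stable
    one; stability forces the latter to vanish at its image. At n = 1 the extension comes from
    surjectivity on H^1, later from [char_lift]. *)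
Lemma phi_inj_fseries n : (0 < n)%N ->
  {in S1, forall x, phi x \in T2 n -> x \in T1 n}.
Proof.
case: n => // n _; elim: n => [|n IHn] x Sx Tpx; apply/idPn=> nTx.
  have [|||chi cM [c0 cx]] := @ex_separating_char p _ S1 (T1 1) x p_pr _ _ _ Sx nTx.
  - exact: fseries_sub.
  - exact: (@fseries_der1 p _ _ F1 0).
  - by move=> t St; apply: (fseries_expp (n := 0)).
  have cF : fstable F1 chi.
    by move=> P f t Ff Pt; apply: (kernel_fstable_on (n := 0) cM c0 Ff Pt); apply: (subsetP (fhom_dom Ff)).
  have [chi2 [c2M c2F] c2E] := induced_char_surj phi1_iso cM cF.
  case/eqP: cx; rewrite -c2E //=.
  apply: (@fstable_on_kernel _ _ _ F2 p_pr 0 chi2 c2M) => // P f t Ff Pt _.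
  exact: c2F Ff Pt.
have Tx : x \in T1 n.+1 by apply: IHn; rewrite // (subsetP (fseriesS p F2 _)).
have [|||chi cM [c0 cx]] := @ex_separating_char p _ (T1 n.+1) (T1 n.+2) x p_pr _ _ _ Tx nTx.
- exact: fseriesS.
- exact: fseries_der1.
- by move=> t Tt; apply: fseries_expp.
have [chi2 [c2M c2F] c2E] := char_lift (ltn0Sn n) IHn cM c0.
case/eqP: cx; rewrite -c2E //=.
exact: (fstable_on_kernel p_pr c2M c2F).
Qed.

Lemma quotient_fseries_isog n : (0 < n)%N -> S1 / T1 n \isog S2 / T2 n.
Proof.
move=> n_gt0; have nT2 := normal_norm (fseries_normal p F2 n).
pose g x := coset (T2 n) (phi x).
have gM : {in S1 &, {morph g : x y / x * y}}.
  by move=> x y Sx Sy; rewrite /g morphM // morphM ?(subsetP nT2) ?phiS.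
have kerg : 'ker (Morphism gM) = T1 n.
  apply/setP=> x; apply/idP/idP=> [kx | Tx].
    have Sx := dom_ker kx; apply: (phi_inj_fseries n_gt0) => //.
    by apply: coset_idr; rewrite ?(subsetP nT2) ?phiS //; exact: (mker kx).
  have Sx := subsetP (fseries_sub p F1 n) x Tx.
  by apply/kerP; rewrite //= /g coset_id // phi_fseries.
have img : Morphism gM @* S1 = S2 / T2 n.
  apply/setP=> z; apply/morphimP/morphimP=> [[x _ Sx ->] | [y Ny Sy ->]].
    by exists (phi x); rewrite ?(subsetP nT2) ?phiS.
  have [x Sx xy] := phi_surj n Sy; exists x => //=; apply/esym.
  by apply/eq_cosetP; rewrite ?(subsetP nT2) ?phiS.
by have := first_isog (Morphism gM); rewrite kerg img.
Qed.

End Comparison.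

Theorem theorem6p6 (p : nat) (p_prime : prime p)
    (gT1 gT2 : finGroupType) (S1 : {group gT1}) (S2 : {group gT2})
    (pS1 : p.-group S1) (pS2 : p.-group S2)
    (F1 : fusion_system S1) (F2 : fusion_system S2)
    (satF1 : saturated p F1) (satF2 : saturated p F2)
    (phi : {morphism S1 >-> gT2}) (phiS : phi @* S1 \subset S2)
    (phiF : fusion_preserving F1 F2 phi)
    (phi1_iso : bijective (induced_map p phiF 1))
    (phi2_mono : injective (induced_map p phiF 2)) :
  (forall n, (1 <= n)%N -> S1 / fseries p F1 n \isog S2 / fseries p F2 n)
  /\ S1 / hyperfocal p F1 \isog S2 / hyperfocal p F2.
Proof.
have iso n : (1 <= n)%N -> S1 / fseries p F1 n \isog S2 / fseries p F2 n.
  exact: (quotient_fseries_isog p_prime pS1 pS2 satF1 satF2 phi1_iso phi2_mono).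
split=> //; have [m1 eq1] := fseries_eventually p_prime pS1 satF1.
have [m2 eq2] := fseries_eventually p_prime pS2 satF2.
(* The successor keeps [m] positive, as [iso] requires. *)
pose m := (m1 + m2).+1.
have le1 : (m1 <= m)%N by rewrite leqW ?leq_addr.
have le2 : (m2 <= m)%N by rewrite leqW ?leq_addl.
by rewrite -(eq1 m le1) -(eq2 m le2); apply: iso.
Qed.
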